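(* Let $\lambda=(\lambda_1,\dots,\lambda_d)$ be a partition of $n$ with exactly $m_1$ parts equal to $1$. The dual variety $(\Delta_\lambda)^\vee$ is the join of $d-m_1$ multiple root loci determined by hook shapes, namely the loci $\Delta_{\{1^{\lambda_i-2},\,n-\lambda_i+2\}}$, where $i$ runs over the indices in $\{1,\dots,d\}$ with $\lambda_i\ge2$.
   Context: $K$ is a field of characteristic zero; points of varieties are taken over an algebraic closure of $K$. $V=K[x,y]_n$ and $V^\vee=K[u,v]_n$ are dual spaces via $\langle f,g\rangle=\frac1{n!}\,g(\frac{\partial}{\partial x},\frac{\partial}{\partial y})f(x,y)$, and $\mathbb{P}(V)$, $\mathbb{P}(V^\vee)$ are both identified with $\mathbb{P}^n$. For a partition $\mu=(\mu_1,\dots,\mu_e)$ of $n$ (also written as a multiset, exponents denoting multiplicities of parts), the multiple root locus $\Delta_\mu\subset\mathbb{P}^n$ is the variety of binary forms of degree $n$ of the form $\ell_1^{\mu_1}\cdots\ell_e^{\mu_e}$ with $\ell_i$ nonzero linear forms. It is defined likewise for forms in $x,y$ and in $u,v$. The dual variety $(\Delta_\lambda)^\vee\subset\mathbb{P}(V^\vee)$ of $\Delta_\lambda\subset\mathbb{P}(V)$ is the closure of the set of $g$ with $g\perp T_f\Delta_\lambda$ for some smooth point $f$ of $\Delta_\lambda$ (equivalently, of hyperplanes tangent to $\Delta_\lambda$). The loci $\Delta_{\{1^{\lambda_i-2},n-\lambda_i+2\}}$ are taken in $\mathbb{P}(V^\vee)$, and the join of subvarieties of projective space is the Zariski closure of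 the union of the linear spans of tuples with one point from each variety (the join of no varieties is empty). *)

(* Defs.v *)
From HB Require Import structures.
From mathcomp Require Import all_boot all_order all_algebra.
From mathcomp Require Import mpoly.

Set Implicit Arguments.
Unset Strict Implicit.
Unset Printing Implicit Defensive.

Import GRing.Theory.

Local Open Scope ring_scope.

(** A subset of the projective space P(L^N) is given by the set of its
    representatives: a predicate on ['rV[L]_N] that only holds at nonzero
    vectors and is invariant under nonzero scalars.  A polynomial [F] in [N]
    variables is evaluated at [a : 'rV[L]_N] as [F.@[a 0]]. *)

Definition vanishes_on (L : fieldType) (N : nat) (X : 'rV[L]_N -> Prop)
    (F : {mpoly L[N]}) : Prop :=
  forall a, X a -> F.@[a 0] = 0.

Definition projective_closure (L : fieldType) (N : nat)
    (X : 'rV[L]_N -> Prop) (a : 'rV[L]_N) : Prop :=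
  a != 0 /\
  forall (k : nat) (F : {mpoly L[N]}),
    F \is k.-homog -> vanishes_on X F -> F.@[a 0] = 0.

(** Zariski tangent space at [f] of the affine cone over (the closure of) [X],
    as a linear subspace of L^N; its projectivization is the embedded projective
    tangent space of [X]. *)
Definition tangent_space (L : fieldType) (N : nat) (X : 'rV[L]_N -> Prop)
    (f v : 'rV[L]_N) : Prop :=
  forall (k : nat) (F : {mpoly L[N]}),
    F \is k.-homog -> vanishes_on X F ->
    \sum_(i < N) (F^`M(i)).@[f 0] * v 0 i = 0.

Definition alg_independent_on (L : fieldType) (N : nat) (X : 'rV[L]_N -> Prop)
    (r : nat) (G : r.-tuple {mpoly L[N]}) : Prop :=
  forall P : {mpoly L[r]}, vanishes_on X (P \mPo G) -> P = 0.

(** The dimension of the affine cone over [X] (one more than the dimension of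
    [X]), as the transcendence degree over [L] of the homogeneous coordinate
    ring of [X]. *)
Definition has_cone_dim (L : fieldType) (N : nat) (X : 'rV[L]_N -> Prop)
    (r : nat) : Prop :=
  (exists G : r.-tuple {mpoly L[N]}, alg_independent_on X G) /\
  (forall (s : nat) (G : s.-tuple {mpoly L[N]}),
      alg_independent_on X G -> (s <= r)%N).

(** For irreducible [X], so that the local dimension is the same everywhere. *)
Definition smooth_point (L : fieldType) (N : nat) (X : 'rV[L]_N -> Prop)
    (f : 'rV[L]_N) : Prop :=
  X f /\
  exists T : {vspace 'rV[L]_N},
    (forall v, v \in T <-> tangent_space X f v) /\ has_cone_dim X (\dim T).

Definition join (L : fieldType) (N : nat) (I : finType)
    (X : I -> 'rV[L]_N -> Prop) : 'rV[L]_N -> Prop :=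
  projective_closure (fun a =>
    a != 0 /\
    exists q : I -> 'rV[L]_N,
      (forall i, X i (q i)) /\ a \in (\sum_(i : I) <[q i]>)%VS).

(** The binary form of degree [n] with coefficient vector [a]: this identifies
    both P(V) and P(V^dual) with P^n.  The variables ['X_0], ['X_1] stand for
    x, y in the first case and for u, v in the second. *)
Definition binary_form (L : fieldType) (n : nat) (a : 'rV[L]_n.+1) :
    {mpoly L[2]} :=
  \sum_(i < n.+1) a 0 i *: ('X_(ord0 : 'I_2) ^+ (n - i) * 'X_(ord_max : 'I_2) ^+ i).

(** [g(d/dx, d/dy) f] *)
Definition diff_action (L : fieldType) (g f : {mpoly L[2]}) : {mpoly L[2]} :=
  \sum_(m <- msupp g) g@_m *: f^`M[m].

(** [<f, g> = g(d/dx, d/dy) f / n!]; the derivative is a constant polynomial,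
    of which we take the value. *)
Definition pairing (L : fieldType) (n : nat) (f g : 'rV[L]_n.+1) : L :=
  (n`!%:R)^-1 * (diff_action (binary_form g) (binary_form f))@_0%MM.

(** The scalar [c] accounts for the choice of a representative. *)
Definition multiple_root_locus (L : fieldType) (n : nat) (mu : seq nat)
    (a : 'rV[L]_n.+1) : Prop :=
  a != 0 /\
  exists (c : L) (l : 'I_(size mu) -> {mpoly L[2]}),
    (forall i, l i \is 1.-homog /\ l i != 0) /\
    binary_form a = c *: \prod_(i < size mu) l i ^+ nth 0%N mu i.

Definition dual_variety (L : fieldType) (n : nat) (X : 'rV[L]_n.+1 -> Prop) :
    'rV[L]_n.+1 -> Prop :=
  projective_closure (fun g =>
    g != 0 /\
    exists f, smooth_point X f /\
              forall v, tangent_space X f v -> pairing v g = 0).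

Definition is_partition (n : nat) (lam : seq nat) : bool :=
  [&& sorted geq lam, all (fun k => (0 < k)%N) lam & sumn lam == n].

(** The hook shape [{1^(k-2), n-k+2}], for [2 <= k <= n]. *)
Definition hook (n k : nat) : seq nat := (n - k + 2)%N :: nseq (k - 2) 1%N.

(* Main.v *)
Require Import Defs.
From HB Require Import structures.
From mathcomp Require Import all_boot all_order all_algebra.
From mathcomp Require Import mpoly.
From Stdlib Require Import Classical.

Set Implicit Arguments.
Unset Strict Implicit.
Unset Printing Implicit Defensive.

Import GRing.Theory.

Local Open Scope ring_scope.

(** The tangent space of the cone over a multiple root locus at
    [f = prod_i l_i ^ lam_i] is [P * L[x,y]_d], where
    [P = prod_i l_i ^ (lam_i - 1)], provided [f] is general.  Indeed, varying
    one factor or rescaling gives the tangent vectors [f / l_i] and [f], which by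
    Lagrange interpolation span [P * L[x,y]_d] when the roots are distinct.  A
    form [g] is orthogonal to all multiples of [P] exactly when it is a sum of
    forms [p_i ^ (n - lam_i + 2) * h_i] with [deg h_i = lam_i - 2], where [p_i]
    is the linear form apolar to [l_i]: pairing with [p_i ^ (n-k) * v^k] computes
    the [k]-th Taylor coefficient at the root of [l_i], and the vanishing of the
    first [lam_i - 1] ones for every [i] is divisibility by [P].  Over an
    algebraically closed field [p ^ (n - lam_i + 2) * h] is an arbitrary element
    of the hook locus, so both varieties are closures of the same set, up to
    degenerate configurations.

    The degenerate configurations are treated by deformation along lines in the
    space of parameters [(c, (l_i)_i)]; the basic tool is
    [polynomial_fun_density].  A smooth point [f] may have colliding roots, but
    its tangent space still contains [P * L[x,y]_d]
    ([cone_tangent_reduced_multiple]), and an orthogonal [g] extends to a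
    polynomial family of orthogonal forms over all parameters
    ([orthogonal_to_reduced_deformation]).  Conversely, a point of the span of
    the hook loci moves in the family in which the [p_i] vary, whose general
    member is orthogonal to the tangent space at a smooth point.

    That a general [f] is smooth ([generic_smooth_point]) needs the dimension of
    the cone and an upper bound for the tangent space.  A chart with [d.+1]
    parameters bounds the dimension, because more polynomials than variables
    are algebraically dependent ([mpoly_alg_dependent]).  The first [d.+1]
    coordinates of the tangent vectors found above are arbitrary, so the ideal of
    relations between these coordinates is stable under derivation, hence zero
    in characteristic zero ([deriv_stable_mpoly_eq0]).  For the same reason every
    further coordinate satisfies a separable equation over the first ones, whose
    gradient determines the remaining coordinates of a tangent vector.

    Forms are handled in the chart [x = 1], as univariate polynomials in [y]. *)

(** * Polynomial functions and density *)

Lemma pchar0_natr_eq0 (L : fieldType) :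
  [pchar L] =i pred0 -> forall k : nat, (k%:R == 0 :> L) = (k == 0)%N.
Proof. by move=> charL; apply/pcharf0P. Qed.

Lemma pchar0_natr_inj (L : fieldType) :
  [pchar L] =i pred0 -> injective (fun k : nat => k%:R : L).
Proof.
move=> /pchar0_natr_eq0 natr0 j k.
wlog le_jk : j k / (j <= k)%N => [th|] e.
  by case/orP: (leq_total j k) => /th; [apply | move/(_ (esym e))->].
have /eqP : (k - j)%:R = 0 :> L by rewrite natrB // e subrr.
by rewrite natr0 subn_eq0 => le_kj; apply/eqP; rewrite eqn_leq le_jk.
Qed.

Lemma pchar0_exists_nonroot (L : fieldType) (p : {poly L}) :
  [pchar L] =i pred0 -> p != 0 -> exists t, p.[t] != 0.
Proof.
move=> charL p_neq0; pose rs := [seq (k%:R : L) | k <- iota 0 (size p)].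
have uniq_rs : uniq rs.
  by rewrite map_inj_uniq ?iota_uniq //; apply: pchar0_natr_inj.
have [/hasP[t _ pt] | /hasPn all0] := boolP (has (fun t => p.[t] != 0) rs).
  by exists t.
have all_root : all (root p) rs.
  by apply/allP => t /all0; rewrite negbK.
have := max_poly_roots p_neq0 all_root uniq_rs.
by rewrite size_map size_iota ltnn.
Qed.

(** Polynomiality is only ever used along lines, and being polynomial along
    every line is stable under all the constructions below without any choice
    of coordinates on the parameter space. *)
Definition polynomial_fun (L : fieldType) (V : lmodType L) (Q : V -> L) : Prop :=
  forall a b, exists q : {poly L}, forall t, Q (a + t *: b) = q.[t].

Definition poly_family (L : fieldType) (V : lmodType L) (P : V -> {poly L}) : Prop :=
  forall k, polynomial_fun (fun v => (P v)`_k).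

Section PolynomialFunctions.

Variables (L : fieldType) (V : lmodType L).
Implicit Types (Q : V -> L) (P : V -> {poly L}).

Lemma eq_polynomial_fun Q1 Q2 :
  Q1 =1 Q2 -> polynomial_fun Q1 -> polynomial_fun Q2.
Proof. by move=> eqQ h a b; have [q hq] := h a b; exists q => t; rewrite -eqQ. Qed.

Lemma polynomial_fun_affine Q :
  (forall a b t, Q (a + t *: b) = Q a + t * Q b) -> polynomial_fun Q.
Proof.
move=> h a b; exists ((Q a)%:P + Q b *: 'X) => t.
by rewrite h !hornerE mulrC.
Qed.

Lemma polynomial_fun_const c : polynomial_fun (fun _ : V => c).
Proof. by move=> a b; exists c%:P => t; rewrite hornerC. Qed.

Lemma polynomial_funD Q1 Q2 : polynomial_fun Q1 -> polynomial_fun Q2 ->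
  polynomial_fun (fun v => Q1 v + Q2 v).
Proof.
move=> h1 h2 a b; have [q1 e1] := h1 a b; have [q2 e2] := h2 a b.
by exists (q1 + q2) => t; rewrite hornerD e1 e2.
Qed.

Lemma polynomial_funM Q1 Q2 : polynomial_fun Q1 -> polynomial_fun Q2 ->
  polynomial_fun (fun v => Q1 v * Q2 v).
Proof.
move=> h1 h2 a b; have [q1 e1] := h1 a b; have [q2 e2] := h2 a b.
by exists (q1 * q2) => t; rewrite hornerM e1 e2.
Qed.

Lemma polynomial_funN Q : polynomial_fun Q -> polynomial_fun (fun v => - Q v).
Proof.
move=> h; apply: eq_polynomial_fun (polynomial_funM (polynomial_fun_const (-1)) h).
by move=> v; rewrite mulN1r.
Qed.

Lemma polynomial_fun_sum (I : Type) (r : seq I) (p : pred I) (Q : I -> V -> L) :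
  (forall i, polynomial_fun (Q i)) ->
  polynomial_fun (fun v => \sum_(i <- r | p i) Q i v).
Proof.
move=> h; elim: r => [|i r IHr].
  by apply: eq_polynomial_fun (polynomial_fun_const 0) => v; rewrite big_nil.
case pi: (p i).
  apply: eq_polynomial_fun (polynomial_funD (h i) IHr) => v.
  by rewrite big_cons pi.
by apply: eq_polynomial_fun IHr => v; rewrite big_cons pi.
Qed.

Lemma polynomial_fun_prod (I : Type) (r : seq I) (p : pred I) (Q : I -> V -> L) :
  (forall i, polynomial_fun (Q i)) ->
  polynomial_fun (fun v => \prod_(i <- r | p i) Q i v).
Proof.
move=> h; elim: r => [|i r IHr].
  by apply: eq_polynomial_fun (polynomial_fun_const 1) => v; rewrite big_nil.
case pi: (p i).
  apply: eq_polynomial_fun (polynomial_funM (h i) IHr) => v.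
  by rewrite big_cons pi.
by apply: eq_polynomial_fun IHr => v; rewrite big_cons pi.
Qed.

Lemma polynomial_funX Q k : polynomial_fun Q -> polynomial_fun (fun v => Q v ^+ k).
Proof.
move=> h; apply: (@eq_polynomial_fun (fun v => \prod_(i < k) Q v)).
  by move=> v; rewrite prodr_const card_ord.
exact: polynomial_fun_prod.
Qed.

Lemma polynomial_fun_meval (N : nat) (F : {mpoly L[N]}) (x : V -> 'I_N -> L) :
  (forall i, polynomial_fun (x^~ i)) -> polynomial_fun (fun v => F.@[x v]).
Proof.
move=> h; apply: (@eq_polynomial_fun
  (fun v => \sum_(m <- msupp F) F@_m * \prod_(i < N) x v i ^+ m i)).
  by move=> v; rewrite mevalE.
apply: polynomial_fun_sum => m; apply: polynomial_funM.
  exact: polynomial_fun_const.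
by apply: polynomial_fun_prod => i; apply: polynomial_funX.
Qed.

Lemma polynomial_fun_det (k : nat) (M : V -> 'M[L]_k) :
  (forall i j, polynomial_fun (fun v => M v i j)) ->
  polynomial_fun (fun v => \det (M v)).
Proof.
move=> h; apply: polynomial_fun_sum => s; apply: polynomial_funM.
  exact: polynomial_fun_const.
by apply: polynomial_fun_prod => i.
Qed.

Lemma polynomial_fun_adj (k : nat) (M : V -> 'M[L]_k) i j :
  (forall i j, polynomial_fun (fun v => M v i j)) ->
  polynomial_fun (fun v => (\adj (M v)) i j).
Proof.
move=> h; apply: (@eq_polynomial_fun (fun v => cofactor (M v) j i)).
  by move=> v; rewrite mxE.
apply: polynomial_funM; first exact: polynomial_fun_const.
apply: polynomial_fun_det => i' j'.
by apply: eq_polynomial_fun (h (lift j i') (lift i j')) => v; rewrite !mxE.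
Qed.

Lemma polynomial_fun_mulmx (k l m : nat) (A : V -> 'M[L]_(k, l)) (B : V -> 'M[L]_(l, m)) :
  (forall i j, polynomial_fun (fun v => A v i j)) ->
  (forall i j, polynomial_fun (fun v => B v i j)) ->
  forall i j, polynomial_fun (fun v => (A v *m B v) i j).
Proof.
move=> hA hB i j.
apply: (@eq_polynomial_fun (fun v => \sum_k A v i k * B v k j)).
  by move=> v; rewrite mxE.
by apply: polynomial_fun_sum => k'; apply: polynomial_funM.
Qed.

Lemma poly_family_const p : poly_family (fun _ : V => p).
Proof. by move=> k; apply: polynomial_fun_const. Qed.

Lemma poly_familyD P1 P2 : poly_family P1 -> poly_family P2 ->
  poly_family (fun v => P1 v + P2 v).
Proof.
move=> h1 h2 k; apply: eq_polynomial_fun (polynomial_funD (h1 k) (h2 k)) => v.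
by rewrite coefD.
Qed.

Lemma poly_familyM P1 P2 : poly_family P1 -> poly_family P2 ->
  poly_family (fun v => P1 v * P2 v).
Proof.
move=> h1 h2 k.
apply: (@eq_polynomial_fun (fun v => \sum_(j < k.+1) (P1 v)`_j * (P2 v)`_(k - j))).
  by move=> v; rewrite coefM.
by apply: polynomial_fun_sum => j; apply: polynomial_funM.
Qed.

Lemma poly_familyZ Q P : polynomial_fun Q -> poly_family P ->
  poly_family (fun v => Q v *: P v).
Proof.
move=> h1 h2 k; apply: eq_polynomial_fun (polynomial_funM h1 (h2 k)) => v.
by rewrite coefZ.
Qed.

Lemma poly_family_prod (I : Type) (r : seq I) (p : pred I) (P : I -> V -> {poly L}) :
  (forall i, poly_family (P i)) ->
  poly_family (fun v => \prod_(i <- r | p i) P i v).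
Proof.
move=> h; elim: r => [|i r IHr] k.
  by apply: eq_polynomial_fun (poly_family_const 1 k) => v; rewrite big_nil.
case pi: (p i).
  apply: eq_polynomial_fun (poly_familyM (h i) IHr k) => v.
  by rewrite big_cons pi.
by apply: eq_polynomial_fun (IHr k) => v; rewrite big_cons pi.
Qed.

Lemma poly_family_sum (I : Type) (r : seq I) (p : pred I) (P : I -> V -> {poly L}) :
  (forall i, poly_family (P i)) ->
  poly_family (fun v => \sum_(i <- r | p i) P i v).
Proof.
move=> h k.
apply: (@eq_polynomial_fun (fun v => \sum_(i <- r | p i) (P i v)`_k)).
  by move=> v; rewrite coef_sum.
by apply: polynomial_fun_sum => i; apply: h.
Qed.

Lemma poly_familyX P k : poly_family P -> poly_family (fun v => P v ^+ k).
Proof.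
move=> h j; apply: (@eq_polynomial_fun (fun v => (\prod_(i < k) P v)`_j)).
  by move=> v; rewrite prodr_const card_ord.
exact: poly_family_prod.
Qed.

Hypothesis charL : [pchar L] =i pred0.

(** On the line through two points at which [Q1] and [Q2] do not vanish, both
    become nonzero univariate polynomials, whose product has a nonroot. *)
Lemma polynomial_fun_common_nonzero Q1 Q2 :
  polynomial_fun Q1 -> polynomial_fun Q2 ->
  (exists v, Q1 v != 0) -> (exists v, Q2 v != 0) ->
  exists v, Q1 v * Q2 v != 0.
Proof.
move=> h1 h2 [a Qa] [b Qb].
have [q1 e1] := h1 a (b - a); have [q2 e2] := h2 a (b - a).
have [|t q12t] := @pchar0_exists_nonroot L (q1 * q2) charL.
  rewrite mulf_eq0 negb_or; apply/andP; split.
    apply: contraNneq Qa => q10.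
    by have := e1 0; rewrite scale0r addr0 q10 horner0 => ->.
  apply: contraNneq Qb => q20.
  by have := e2 1; rewrite scale1r addrC subrK q20 horner0 => ->.
by exists (a + t *: (b - a)); rewrite e1 e2 -hornerM.
Qed.

Lemma polynomial_fun_prod_common_nonzero (I : Type) (r : seq I) (Q : I -> V -> L) :
  (forall i, polynomial_fun (Q i)) -> (forall i, exists v, Q i v != 0) ->
  exists v, \prod_(i <- r) Q i v != 0.
Proof.
move=> h hQ; elim: r => [|i r IHr]; first by exists 0; rewrite big_nil oner_eq0.
have [|v] := polynomial_fun_common_nonzero (h i) _ (hQ i) IHr.
  exact: polynomial_fun_prod.
by exists v; rewrite big_cons.
Qed.

(** The tool for all degenerations: an identity between polynomial functions
    that holds where [W] does not vanish holds everywhere. *)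
Lemma polynomial_fun_density W Q :
  polynomial_fun W -> polynomial_fun Q -> (exists v, W v != 0) ->
  (forall v, W v != 0 -> Q v = 0) -> forall v, Q v = 0.
Proof.
move=> hW hQ exW WQ v; apply/eqP; apply/negPn/negP => Qv.
have [|w] := polynomial_fun_common_nonzero hW hQ exW; first by exists v.
by rewrite mulf_eq0 negb_or => /andP[/WQ-> /negP[]].
Qed.

End PolynomialFunctions.

(** * Derivatives of composites *)

(** The chain rule for the evaluation of multivariate polynomials in any
    algebra with a derivation; it holds for variables and constants and is
    inherited by sums and products. *)
Lemma derivation_mmap (L : fieldType) (A : comNzRingType) (f : {rmorphism L -> A})
    (D : A -> A) (N : nat) (a : 'I_N -> A) (F : {mpoly L[N]}) :
  (forall c, D (f c) = 0) -> {morph D : x y / x + y} ->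
  (forall x y, D (x * y) = D x * y + x * D y) ->
  D (mmap f a F) = \sum_(i < N) mmap f a F^`M(i) * D (a i).
Proof.
move=> Df DD DM.
pose S (p : {mpoly L[N]}) := D (mmap f a p) = \sum_(i < N) mmap f a p^`M(i) * D (a i).
have SC c : S c%:MP.
  by rewrite /S mmapC Df big1 // => i _; rewrite mderivC mmap0 mul0r.
have SD p q : S p -> S q -> S (p + q).
  rewrite /S mmapD DD => -> ->.
  under [RHS]eq_bigr do rewrite mderivD mmapD mulrDl.
  by rewrite big_split /=; congr (_ + _).
have SM p q : S p -> S q -> S (p * q).
  rewrite /S rmorphM DM /= => -> ->.
  under [RHS]eq_bigr do rewrite mderivM mmapD !rmorphM /= mulrDl mulrAC -[X in _ + X]mulrA.
  rewrite big_split /=; congr (_ + _); first by rewrite [LHS]mulr_suml.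
  by rewrite [LHS]mulr_sumr.
have SX i : S 'X_i.
  rewrite /S mmapX mmap1U (bigD1 i) //= mderivX mnm1E eqxx scale1r.
  rewrite -[X in 'X_[X - _]]addm0 addmC addmK mpolyX0 rmorph1 mul1r big1 ?addr0 // => j ji.
  by rewrite mderivX mnm1E eq_sym (negbTE ji) scale0r mmap0 mul0r.
rewrite -/(S F); elim/mpolyind: F => [|c m p _ _ Sp]; first by rewrite -mpolyC0.
apply: SD => //; rewrite -mul_mpolyC; apply: (SM); first exact: (SC).
rewrite mpolyXE_id.
apply: (@big_ind _ S _ _ (SC 1) SM) => i _; elim: (m i) => [|k IHk].
  by rewrite expr0; apply: (SC 1).
by rewrite exprS; apply: SM.
Qed.

Lemma deriv_mmap (L : fieldType) (N : nat) (a : 'I_N -> {poly L}) (F : {mpoly L[N]}) :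
  (mmap polyC a F)^`() = \sum_(i < N) mmap polyC a F^`M(i) * (a i)^`().
Proof. by apply: derivation_mmap => [c|x y|x y]; rewrite ?derivC ?derivD ?derivM. Qed.

Lemma mderiv_comp_mpoly (L : fieldType) (N s : nat) (G : s.-tuple {mpoly L[N]})
    (F : {mpoly L[s]}) (k : 'I_N) :
  (F \mPo G)^`M(k) = \sum_(i < s) (F^`M(i) \mPo G) * (tnth G i)^`M(k).
Proof. by apply: derivation_mmap => [c|x y|x y]; rewrite ?mderivC ?mderivD ?mderivM. Qed.

Lemma horner_mmap (L : fieldType) (N : nat) (a : 'I_N -> {poly L}) (F : {mpoly L[N]}) t :
  (mmap polyC a F).[t] = F.@[fun i => (a i).[t]].
Proof.
rewrite mevalE /mmap horner_sum; apply: eq_bigr => m _.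
rewrite hornerM hornerC /mmap1 horner_prod; congr (_ * _).
by apply: eq_bigr => i _; rewrite horner_exp.
Qed.

(** Differentiating the relation [F = 0] along the curve [a]. *)
Lemma gradient_along_curve (L : fieldType) (N : nat) (a : 'I_N -> {poly L}) (F : {mpoly L[N]}) :
  [pchar L] =i pred0 -> (forall t, F.@[fun i => (a i).[t]] = 0) ->
  \sum_(i < N) (F^`M(i)).@[fun i => (a i)`_0] * (a i)`_1 = 0.
Proof.
move=> charL Fa0.
have mF0 : mmap polyC a F = 0.
  apply/eqP; apply/negPn/negP => /(pchar0_exists_nonroot charL)[t].
  by rewrite horner_mmap Fa0 eqxx.
have /(congr1 (fun p : {poly L} => p.[0])) := deriv_mmap a F.
rewrite mF0 deriv0 horner0 horner_sum => e; rewrite [RHS]e; apply: eq_bigr => i _.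
rewrite hornerM horner_mmap [_^`().[0]]horner_coef0 coef_deriv mulr1n; congr (_ * _).
by apply: meval_eq => j; rewrite horner_coef0.
Qed.

(** * Algebraic dependence *)

(** A nonzero element of [I] of least degree would have zero derivatives, so in
    characteristic zero it would be a nonzero constant. *)
Lemma deriv_stable_mpoly_eq0 (L : fieldType) (s : nat) (I : {mpoly L[s]} -> Prop) :
  [pchar L] =i pred0 -> (forall c, I c%:MP -> c = 0) ->
  (forall P k, I P -> I P^`M(k)) -> forall P, I P -> P = 0.
Proof.
move=> charL I0 Id P; have [b] := ubnP (msize P); elim: b P => // b IHb P ltPb IP.
have dP k : P^`M(k) = 0.
  have [//|nz] := eqVneq (P^`M(k)) 0; apply: IHb (Id _ k IP).
  rewrite -(mlead_deg nz) -ltnS; apply: leq_ltn_trans ltPb.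
  have : (mlead P^`M(k) + U_(k))%MM \in msupp P.
    have := mlead_supp nz; rewrite !mcoeff_msupp mcoeff_deriv.
    by apply: contraNneq => ->; rewrite mul0rn.
  by move/msize_mdeg_lt; rewrite mdegD mdeg1 addn1.
suff eP : P = (P@_0)%:MP by rewrite eP in IP *; rewrite (I0 _ IP) mpolyC0.
apply/mpolyP => m; rewrite mcoeffC.
have [->|m0] := eqVneq m 0%MM; first by rewrite mulr1.
rewrite mulr0; have [k mk] : exists k, m k != 0%N.
  apply/existsP; rewrite -negb_forall; apply: contra m0 => /forallP m0.
  by apply/eqP/mnmP => k; rewrite mnm0E; apply/eqP.
have := mcoeff_deriv k (m - U_(k))%MM P; rewrite dP mcoeff0 submK; last first.
  by apply/mnm_lepP => j; rewrite mnm1E; case: eqP => // <-; rewrite lt0n.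
by move/esym/eqP; rewrite -mulr_natr mulf_eq0 pchar0_natr_eq0 // orbF => /eqP.
Qed.

Lemma msize_mul_le_add (L : fieldType) (m : nat) (p q : {mpoly L[m]}) :
  (msize (p * q) <= msize p + msize q)%N.
Proof.
have [->|p_neq0] := eqVneq p 0; first by rewrite mul0r msize0.
have [->|q_neq0] := eqVneq q 0; first by rewrite mulr0 msize0.
by rewrite msizeM // leq_pred.
Qed.

Lemma msize_exp_le (L : fieldType) (m B e : nat) (p : {mpoly L[m]}) :
  (msize p <= B)%N -> (msize (p ^+ e) <= e * B + 1)%N.
Proof.
move=> pB; elim: e => [|e IHe]; first by rewrite expr0 msize1.
rewrite exprS mulSn -addnA; apply: leq_trans (msize_mul_le_add _ _) _.
exact: leq_add.
Qed.

Lemma msize_monomial_comp_le (L : fieldType) (s m B D : nat) (G : s.-tuple {mpoly L[m]})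
    (e : 'I_s -> nat) :
  (forall i, msize (tnth G i) <= B)%N -> (forall i, e i <= D)%N ->
  (msize (\prod_(i < s) tnth G i ^+ e i) <= s * (D * B + 1) + 1)%N.
Proof.
move=> GB eD.
have bound (r : seq 'I_s) :
  (msize (\prod_(i <- r) tnth G i ^+ e i) <= size r * (D * B + 1) + 1)%N.
  elim: r => [|i r IHr]; first by rewrite big_nil msize1.
  rewrite big_cons /= mulSn -addnA; apply: leq_trans (msize_mul_le_add _ _) _.
  apply: leq_add IHr; apply: leq_trans (msize_exp_le _ (GB i)) _.
  by rewrite leq_add2r leq_mul2r eD orbT.
by have := bound (index_enum 'I_s); rewrite -[index_enum _]enumT size_enum_ord.
Qed.

Lemma exists_expn_gt (a m s : nat) : (m < s)%N ->
  exists2 D, (0 < D)%N & ((D * a) ^ m < D ^ s)%N.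
Proof.
move=> lt_ms; exists (a ^ m).+1 => //; set D := (a ^ m).+1.
rewrite expnMn mulnC; apply: (@leq_trans (D ^ m.+1)%N).
  by rewrite expnS ltn_pmul2r ?expn_gt0.
by rewrite leq_pexp2l.
Qed.

(** More polynomials than variables are algebraically dependent: the number of
    monomials with exponents below [D] in [s] letters outgrows the dimension of
    the space in which their values in [m] variables live. *)
Lemma mpoly_alg_dependent (L : fieldType) (s m : nat) (G : s.-tuple {mpoly L[m]}) :
  (m < s)%N -> exists2 P : {mpoly L[s]}, P != 0 & P \mPo G = 0.
Proof.
move=> lt_ms; pose B := (\max_(i < s) msize (tnth G i))%N.
have GB i : (msize (tnth G i) <= B)%N by exact: leq_bigmax.
have [D D_gt0 ltD] := exists_expn_gt (s * (B + 1) + 1) lt_ms.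
(* [E] exceeds the exponents in the values of the chosen monomials. *)
pose E := (s * (D * B + 1) + 1)%N.
have leE : (E <= D * (s * (B + 1) + 1))%N.
  rewrite /E [leqRHS]mulnDr muln1; apply: leq_add => //.
  rewrite [leqRHS]mulnCA leq_mul2l [(D * (B + 1))%N]mulnDr muln1.
  by rewrite leq_add2l D_gt0 orbT.
pose T1 : finType := {ffun 'I_s -> 'I_D}; pose T2 : finType := {ffun 'I_m -> 'I_E}.
pose mn (k b : nat) (e : {ffun 'I_k -> 'I_b}) := [multinom (e i : nat) | i < k].
have mn_inj k b : injective (@mn k b).
  by move=> e e' /mnmP ee; apply/ffunP => i; apply/val_inj; have := ee i; rewrite !mnmE.
pose GX (e : T1) := \prod_(i < s) tnth G i ^+ e i.
pose A := \matrix_(i < #|T1|, j < #|T2|) (GX (enum_val i))@_(mn _ _ (enum_val j)).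
have : kermx A != 0.
  rewrite kermx_eq0; apply/negP => /eqP rA; have := rank_leq_col A.
  rewrite rA !card_ffun !card_ord leqNgt => /negP; apply; apply: leq_ltn_trans ltD.
  by have [->//|m_gt0] := posnP m; rewrite leq_exp2r.
rewrite -nz_row_eq0; set u := nz_row _ => u_neq0.
have uA : u *m A = 0 by apply/sub_kermxP; exact: nz_row_sub.
pose P := \sum_i u 0 i *: 'X_[mn _ _ (enum_val i)].
have PE i : P@_(mn _ _ (enum_val i)) = u 0 i.
  rewrite /P raddf_sum (bigD1 i) //= mcoeffZ mcoeffX eqxx mulr1 big1 ?addr0 // => j ji.
  rewrite mcoeffZ mcoeffX; case: eqP => [/mn_inj/enum_val_inj e|]; last by rewrite mulr0.
  by rewrite e eqxx in ji.
exists P.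
  apply: contraNneq u_neq0 => P0; apply/eqP/rowP => i.
  by rewrite -PE P0 mcoeff0 mxE.
have -> : P \mPo G = \sum_i u 0 i *: GX (enum_val i).
  rewrite /P raddf_sum; apply: eq_bigr => i _ /=.
  rewrite comp_mpolyZ comp_mpolyX; congr (_ *: _); apply: eq_bigr => k _.
  by rewrite mnmE.
apply/mpolyP => w; rewrite mcoeff0 raddf_sum /=.
have [wE | /forallPn[k]] := boolP [forall k, w k < E]%N.
  pose e : T2 := [ffun k => Ordinal (forallP wE k)].
  have -> : w = mn _ _ (enum_val (enum_rank e)).
    by apply/mnmP => k; rewrite enum_rankK mnmE ffunE.
  transitivity ((u *m A) 0 (enum_rank e)); last by rewrite uA mxE.
  by rewrite mxE; apply: eq_bigr => i _; rewrite mcoeffZ mxE.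
rewrite -leqNgt => wE; apply: big1 => i _; rewrite mcoeffZ.
apply/eqP; rewrite mulf_eq0; apply/orP; right; apply: contraLR wE.
rewrite mcoeff_eq0 negbK => /msize_mdeg_lt wlt; rewrite -ltnNge.
apply: leq_ltn_trans (leq_trans wlt _).
  by rewrite mdegE (bigD1 k) //= leq_addr.
by apply: msize_monomial_comp_le => // j; apply: ltnW.
Qed.

(** * Binary forms as univariate polynomials *)

Definition dehomogenize (L : fieldType) : {mpoly L[2]} -> {poly L} :=
  mmap (@polyC L) (fun i => if i == ord0 then 1 else 'X).

Definition binary_mnm (n i : nat) : 'X_{1..2} :=
  (U_(ord0) *+ (n - i) + U_(ord_max) *+ i)%MM.

Definition linear_poly (L : fieldType) (u : L * L) : {poly L} :=
  u.1%:P + u.2 *: 'X.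

Section BinaryForms.

Variable L : fieldType.
Implicit Types (n i k : nat) (F : {mpoly L[2]}) (u : L * L).

Lemma mdeg_binary_mnm n i : (i <= n)%N -> mdeg (binary_mnm n i) = n.
Proof. by move=> le_in; rewrite mdegD !mdegMn !mdeg1 !mul1n subnK. Qed.

Lemma binary_mnm0 n i : binary_mnm n i ord0 = (n - i)%N.
Proof. by rewrite mnmDE !mulmnE !mnm1E /= ?muln1 ?muln0 ?mul1n ?mul0n addn0. Qed.

Lemma binary_mnm1 n i : binary_mnm n i ord_max = i.
Proof. by rewrite mnmDE !mulmnE !mnm1E /= ?muln1 ?muln0 ?mul1n ?mul0n ?add0n. Qed.

Lemma binary_mnmE n (m : 'X_{1..2}) : mdeg m = n -> m = binary_mnm n (m ord_max).
Proof.
move=> dm; apply/mnmP => k.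
have {dm} : (m ord0 + m ord_max)%N = n.
  rewrite -dm mdegE big_ord_recl big_ord1; congr (_ + m _)%N; exact/val_inj.
case: (eqVneq k ord0) => [->|k0]; first by rewrite binary_mnm0 => <-; rewrite addnK.
have -> : k = ord_max by case: k k0 => [[|[|//]] ?] //= _; apply/val_inj.
by rewrite binary_mnm1.
Qed.

Lemma binary_formE n (a : 'rV[L]_n.+1) :
  binary_form a = \sum_(i < n.+1) a 0 i *: 'X_[binary_mnm n i].
Proof.
by apply: eq_bigr => i _; rewrite mpolyXD -!mpolyXn.
Qed.

Lemma binary_mnm_inj n : injective (binary_mnm n).
Proof. by move=> i j /mnmP/(_ ord_max); rewrite !binary_mnm1. Qed.

Lemma mcoeff_binary_form n (a : 'rV[L]_n.+1) (i : 'I_n.+1) :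
  (binary_form a)@_(binary_mnm n i) = a 0 i.
Proof.
rewrite binary_formE raddf_sum (bigD1 i) //= mcoeffZ mcoeffX eqxx mulr1 big1 ?addr0 // => j ji.
rewrite mcoeffZ mcoeffX; case: eqP => [/binary_mnm_inj/val_inj e|_]; last by rewrite mulr0.
by rewrite e eqxx in ji.
Qed.

Lemma binary_form_homog n (a : 'rV[L]_n.+1) : binary_form a \is n.-homog.
Proof.
rewrite binary_formE; apply: rpred_sum => i _; apply: rpredZ.
by rewrite dhomogX /= mdeg_binary_mnm // -ltnS.
Qed.

Lemma homog_binary_form n F :
  F \is n.-homog -> F = binary_form (\row_i F@_(binary_mnm n (i : 'I_n.+1))).
Proof.
move=> homF; apply/mpolyP => m; have [dm|dm] := eqVneq (mdeg m) n.
  have ltm : (m ord_max < n.+1)%N by rewrite ltnS -dm mdegE (bigD1 ord_max) //= leq_addr.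
  by rewrite (binary_mnmE dm) (mcoeff_binary_form _ (Ordinal ltm)) mxE.
by rewrite (dhomog_nemf_coeff homF dm) (dhomog_nemf_coeff (binary_form_homog _) dm).
Qed.

Lemma dehomogenizeZ c F : dehomogenize (c *: F) = c *: dehomogenize F.
Proof. by rewrite /dehomogenize mmapZ mul_polyC. Qed.

Lemma dehomogenize_prod (I : Type) (r : seq I) (F : I -> {mpoly L[2]}) (e : I -> nat) :
  dehomogenize (\prod_(i <- r) F i ^+ e i) = \prod_(i <- r) dehomogenize (F i) ^+ e i.
Proof.
rewrite /dehomogenize rmorph_prod; apply: eq_bigr => i _ /=.
by rewrite rmorphXn.
Qed.

Lemma rVpolyE n (a : 'rV[L]_n) : rVpoly a = \sum_(i < n) a 0 i *: 'X^i.
Proof.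
rewrite [a in LHS]row_sum_delta linear_sum; apply: eq_bigr => i _.
by rewrite linearZ /= rVpoly_delta.
Qed.

Lemma dehomogenize_binary_form n (a : 'rV[L]_n.+1) :
  dehomogenize (binary_form a) = rVpoly a.
Proof.
rewrite /binary_form rVpolyE /dehomogenize raddf_sum /=; apply: eq_bigr => i _.
rewrite mmapZ rmorphM !rmorphXn /= !mmapX !mmap1U eqxx expr1n mul1r.
by rewrite mul_polyC.
Qed.

(** A form of known degree is determined by its restriction to the chart
    [x = 1]. *)
Lemma dehomogenize_inj n F1 F2 : F1 \is n.-homog -> F2 \is n.-homog ->
  dehomogenize F1 = dehomogenize F2 -> F1 = F2.
Proof.
move=> /homog_binary_form-> /homog_binary_form->.
by rewrite !dehomogenize_binary_form => /(can_inj rVpolyK)->.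
Qed.

Lemma linear_form_dehomogenize F : F \is 1.-homog ->
  dehomogenize F = linear_poly (F@_(binary_mnm 1 0), F@_(binary_mnm 1 1)).
Proof.
move=> homF; rewrite {1}(homog_binary_form homF) dehomogenize_binary_form rVpolyE.
by rewrite big_ord_recl big_ord1 !mxE expr0 alg_polyC.
Qed.

Lemma linear_poly_eq0 u : (linear_poly u == 0) = (u == 0).
Proof.
apply/eqP/eqP => [e|->]; last by rewrite /linear_poly scale0r addr0.
have := congr1 (fun p : {poly L} => p`_0) e; have := congr1 (fun p : {poly L} => p`_1) e.
rewrite /linear_poly !coefD !coefZ !coefC !coefX /= mulr0 mulr1 addr0 add0r.
by case: u {e} => u1 u2 /= -> ->.
Qed.

Definition linear_form u : {mpoly L[2]} :=
  binary_form (\row_(i < 2) (if i == 0 then u.1 else u.2)).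

Lemma dehomogenize_linear_form u : dehomogenize (linear_form u) = linear_poly u.
Proof.
rewrite dehomogenize_binary_form rVpolyE big_ord_recl big_ord1 !mxE /=.
by rewrite expr0 alg_polyC.
Qed.

Lemma linear_form_neq0 u : u != 0 -> linear_form u != 0.
Proof.
apply: contraNneq => a0; rewrite -linear_poly_eq0 -dehomogenize_linear_form a0.
by rewrite /dehomogenize mmap0.
Qed.

Lemma homog_prod_linear n (mu : seq nat) (F : nat -> {mpoly L[2]}) :
  (forall i, F i \is 1.-homog) -> sumn mu = n ->
  \prod_(i < size mu) F i ^+ nth 0%N mu i \is n.-homog.
Proof.
move=> homF <-; elim: mu F homF => [|k mu IHmu] F homF /=.
  by rewrite big_ord0 dhomog1.
rewrite big_ord_recl /=; apply: dhomogM; first by have := dhomogMn k (homF 0%N); rewrite mul1n.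
exact: (IHmu (fun i => F i.+1)).
Qed.

Lemma multiple_root_locusP n (mu : seq nat) (a : 'rV[L]_n.+1) : sumn mu = n ->
  multiple_root_locus mu a <->
  a != 0 /\ exists (c : L) (u : nat -> L * L), (forall i, u i != 0) /\
    rVpoly a = c *: \prod_(i < size mu) linear_poly (u i) ^+ nth 0%N mu i.
Proof.
move=> sum_mu; split=> [[a0 [c [l [hl ea]]]]|[a0 [c [u [u0 ea]]]]]; split=> //; exists c.
  (* Outside the range of indices any nonzero pair would do. *)
  pose u k : L * L := if insub k is Some i
    then ((l i)@_(binary_mnm 1 0), (l i)@_(binary_mnm 1 1)) else (1, 0).
  have uE (i : 'I_(size mu)) : dehomogenize (l i) = linear_poly (u i).
    by rewrite /u valK linear_form_dehomogenize //; have [] := hl i.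
  exists u; split=> [k|].
    case: (insubP 'I_(size mu) k) => [i _ <-|kmu]; last first.
      by rewrite /u insubN // xpair_eqE oner_eq0.
    have [li li0] := hl i; apply: contraNneq li0 => u0; apply/eqP.
    apply: (dehomogenize_inj li (rpred0 _)).
    by rewrite uE u0 /linear_poly scale0r addr0 /dehomogenize mmap0.
  rewrite -dehomogenize_binary_form ea dehomogenizeZ dehomogenize_prod.
  by congr (_ *: _); apply: eq_bigr => i _; rewrite uE.
exists (fun i => linear_form (u i)); split=> [i|].
  by split; [apply: binary_form_homog | apply: linear_form_neq0].
apply: (@dehomogenize_inj n); first exact: binary_form_homog.
  apply/rpredZ/(homog_prod_linear (F := fun i => linear_form (u i))) => // i.
  exact: binary_form_homog.
rewrite dehomogenize_binary_form ea dehomogenizeZ dehomogenize_prod.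
by congr (_ *: _); apply: eq_bigr => i _; rewrite dehomogenize_linear_form.
Qed.

Lemma size_linear_poly u : (size (linear_poly u) <= 2)%N.
Proof.
apply: leq_trans (size_polyD _ _) _; rewrite geq_max; apply/andP; split.
  by apply: leq_trans (size_polyC_leq1 _) _.
by apply: leq_trans (size_scale_leq _ _) _; rewrite size_polyX.
Qed.

Lemma size_prod_linear_poly (I : Type) (r : seq I) (v : I -> L * L) (e : I -> nat) :
  (size (\prod_(i <- r) linear_poly (v i) ^+ e i)%R <= (\sum_(i <- r) e i).+1)%N.
Proof.
elim: r => [|i r IHr]; first by rewrite !big_nil size_poly1.
rewrite !big_cons; apply: leq_trans (size_polyMleq _ _) _.
have hX : (size (linear_poly (v i) ^+ e i)%R <= (e i).+1)%N.
  apply: leq_trans (size_poly_exp_leq _ _) _; rewrite ltnS.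
  rewrite -[leqRHS]mul1n leq_mul2r; have := size_linear_poly (v i).
  by case: (size _) => [|[|[|]]] //=; rewrite orbT.
have := leq_add hX IHr; rewrite addSn addnS.
by case: (size _ + size _)%N.
Qed.

End BinaryForms.

(** The simple linear factors of a point of the hook locus multiply to an
    arbitrary cofactor, since the field is algebraically closed. *)
Lemma hook_locusP (L : closedFieldType) (n k : nat) (a : 'rV[L]_n.+1) :
  (2 <= k <= n)%N ->
  multiple_root_locus (hook n k) a <->
  a != 0 /\ exists (u : L * L) (h : {poly L}),
    (size h <= k - 1)%N /\ rVpoly a = linear_poly u ^+ (n - k + 2) * h.
Proof.
case/andP => k2 kn; have sum_hook : sumn (hook n k) = n.
  by rewrite /= sumn_nseq mul1n -addnA subnKC // subnK.
rewrite multiple_root_locusP //= size_nseq.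
have nthE (i : 'I_(k - 2)) : nth 0%N (nseq (k - 2) 1%N) i = 1%N.
  by rewrite nth_nseq ltn_ord.
have k1 : (k - 1 = (k - 2).+1)%N by rewrite subnSK.
split=> [[a0 [c [u [u0 ea]]]]|[a0 [u [h [hk ea]]]]]; split=> //.
  exists (u 0%N), (c *: \prod_(i < k - 2) linear_poly (u i.+1)); split.
    apply: leq_trans (size_scale_leq _ _) _.
    have := size_prod_linear_poly (index_enum 'I_(k - 2)) (fun i => u i.+1) (fun=> 1%N).
    by rewrite sum1_size -[index_enum _]enumT size_enum_ord k1.
  rewrite ea big_ord_recl /= scalerAr; congr (_ * (_ *: _)).
  by apply: eq_bigr => i _; rewrite nthE expr1.
have h0 : h != 0.
  apply: contraNneq a0 => h0; rewrite -(rVpolyK a) ea h0 mulr0; apply/eqP.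
  by apply/rowP => i; rewrite !mxE coef0.
have u0 : u != 0.
  apply: contraNneq a0 => u0; rewrite -(rVpolyK a) ea u0 /linear_poly scale0r addr0.
  by rewrite addn2 exprS mul0r mul0r; apply/eqP/rowP => i; rewrite !mxE coef0.
have [r hr] := closed_field_poly_normal h.
have szr : (size r <= k - 2)%N.
  move: hk; rewrite hr size_scale ?lead_coef_eq0 // size_prod_XsubC k1 ltnS.
  exact.
(* The pairs [(1, 0)] stand for the factor [x], which is [1] in the chart: [h]
   may have fewer roots than its degree as a form. *)
exists (lead_coef h), (fun i => if i is j.+1 then
  (if (j < size r)%N then (- r`_j, 1) else (1, 0)) else u); split.
  by case=> [|j] //; case: ifP; rewrite xpair_eqE oner_eq0 ?andbF.
rewrite ea big_ord_recl /= scalerAr; congr (_ * _); rewrite {1}hr; congr (_ *: _).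
rewrite (big_nth 0) big_mkord (big_ord_widen _ (fun i => ('X - (r`_i)%:P)) szr).
rewrite big_mkcond /=; apply: eq_bigr => i _.
rewrite nthE expr1; case: ifP => _; rewrite /linear_poly /= ?scale1r ?polyCN ?scale0r ?addr0 //.
by rewrite addrC.
Qed.

(** Monomials of the same degree are orthogonal unless they have equal exponents. *)
Lemma pairingE (L : fieldType) (n : nat) (f g : 'rV[L]_n.+1) :
  pairing f g = \sum_(i < n.+1) f 0 i * g 0 i * ((n`!)%:R^-1 * (i`! * (n - i)`!)%:R).
Proof.
rewrite /pairing /diff_action raddf_sum /=.
pose phi m := (binary_form f)@_m * (\prod_(i < 2) (m i)`!)%:R.
transitivity (n`!%:R^-1 * \sum_(m <- msupp (binary_form g)) (binary_form g)@_m * phi m).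
  congr (_ * _); apply: eq_bigr => m _; rewrite mcoeffZ mcoeff_mderivm addm0.
  rewrite -mulr_natr; congr (_ * (_ * _%:R)); apply: eq_bigr => i _.
  by rewrite ffactnn.
have pe : perm_eq (msupp (binary_form g))
    [seq binary_mnm n (i : 'I_n.+1) | i <- enum 'I_n.+1 & g 0 i != 0].
  apply: uniq_perm; first exact: msupp_uniq.
    rewrite map_inj_uniq; first exact/filter_uniq/enum_uniq.
    move=> i j /binary_mnm_inj.
    exact: val_inj.
  move=> m; apply/idP/mapP => [mg|[i]].
    have dm : mdeg m = n := dhomog_mf (binary_form_homog g) mg.
    have ltm : (m ord_max < n.+1)%N by rewrite ltnS -dm mdegE (bigD1 ord_max) //= leq_addr.
    exists (Ordinal ltm); last exact: binary_mnmE.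
    rewrite mem_filter mem_enum andbT -mcoeff_binary_form /= -binary_mnmE //.
    by rewrite -mcoeff_msupp.
  by rewrite mem_filter => /andP[gi _] ->; rewrite mcoeff_msupp mcoeff_binary_form.
rewrite (perm_big _ pe) big_map big_filter big_enum_cond /= mulr_sumr big_mkcond /=.
apply: eq_bigr => i _; case: eqP => [-> | _]; first by rewrite mulr0 mul0r.
rewrite /phi !mcoeff_binary_form big_ord_recl big_ord1.
have -> : lift ord0 ord0 = ord_max :> 'I_2 by apply/val_inj.
rewrite binary_mnm0 binary_mnm1 [((n - i)`! * _)%N]mulnC mulrCA !mulrA.
by congr (_ * _); rewrite mulrAC [g 0 i * _]mulrC.
Qed.

(** * The cone over a multiple root locus and its tangent spaces *)

(** The coefficients [c] are found by evaluating at the [rho i], where all but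
    one of the partial products vanish; what remains is divisible by the full
    product, hence a scalar multiple of it for reasons of degree. *)
Lemma lagrange_span (L : fieldType) (d : nat) (l : 'I_d -> {poly L})
    (b rho : 'I_d -> L) (h : {poly L}) :
  (forall i, l i = b i *: ('X - (rho i)%:P)) -> (forall i, b i != 0) ->
  injective rho -> (size h <= d.+1)%N ->
  exists e (c : 'I_d -> L),
    h = e *: \prod_i l i + \sum_i c i *: \prod_(j | j != i) l j.
Proof.
move=> lE b0 rho_inj hd.
have lv i j : ((l i).[rho j] == 0) = (i == j).
  rewrite lE hornerZ hornerXsubC mulf_eq0 (negbTE (b0 i)) subr_eq0.
  by rewrite (inj_eq rho_inj) eq_sym.
pose Q i := \prod_(j | j != i) l j.
have Qv i j : ((Q i).[rho j] == 0) = (i != j).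
  rewrite horner_prod; apply/prodf_eq0/idP => [[k ki]|ij].
    by rewrite lv => /eqP kj; rewrite -kj eq_sym.
  by exists j; rewrite ?lv // eq_sym.
pose c i := h.[rho i] / (Q i).[rho i].
pose g := h - \sum_i c i *: Q i.
have g_root i : root g (rho i).
  rewrite /root hornerD hornerN horner_sum (bigD1 i) //= big1 => [|j ji].
    by rewrite hornerZ addr0 divfK ?subrr // Qv eqxx.
  have /eqP Q0 : (Q j).[rho i] == 0 by rewrite Qv.
  by rewrite hornerZ Q0 mulr0.
have sizeQ i : (size (Q i) <= d)%N.
  have l2 j : (size (l j) <= 2)%N.
    by rewrite lE; apply: leq_trans (size_scale_leq _ _) _; rewrite size_XsubC.
  apply: leq_trans (size_poly_prod_leq _ _) _; rewrite leq_subLR.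
  apply: (@leq_trans (\sum_(j | j != i) 2).+1); first by rewrite ltnS leq_sum.
  have cd : #|[pred j | j != i]|.+1 = d.
    by rewrite cardC1 card_ord prednK // (leq_ltn_trans _ (ltn_ord i)).
  by rewrite sum_nat_const muln2 -addnn -addnS cd.
have gd : (size g <= d.+1)%N.
  apply: leq_trans (size_polyD _ _) _; rewrite geq_max hd size_polyN.
  apply: leq_trans (size_sum _ _ _) _; apply/bigmax_leqP => i _.
  by apply: leq_trans (size_scale_leq _ _) (leq_trans (sizeQ i) _).
have [||q gq] := @uniq_roots_prod_XsubC _ g [seq rho i | i <- enum 'I_d].
- by apply/allP => _ /mapP[i _ ->]; apply: g_root.
- by rewrite uniq_rootsE map_inj_uniq ?enum_uniq.
have {gq gd} [e ge] : exists e, g = e *: \prod_i l i.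
  have -> : \prod_i l i = (\prod_i b i) *: \prod_i ('X - (rho i)%:P).
    by rewrite -scaler_prod; apply: eq_bigr.
  have e1 : \prod_(z <- [seq rho i | i <- enum 'I_d]) ('X - z%:P) = \prod_i ('X - (rho i)%:P).
    by rewrite big_map big_enum.
  have b_neq0 : \prod_i b i != 0 by apply/prodf_neq0.
  have [q0|q_neq0] := eqVneq q 0; first by exists 0; rewrite gq q0 mul0r scale0r.
  have : (size q <= 1)%N.
    move: gd; rewrite gq size_Mmonic ?monic_prod_XsubC //.
    by rewrite size_prod_XsubC size_map size_enum_ord addnS /= -add1n leq_add2r.
  move/size1_polyC => qc; exists (q`_0 / \prod_i b i).
  by rewrite scalerA divfK // gq e1 {1}qc mul_polyC.
by exists e, c; rewrite -ge subrK.
Qed.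

Section RootLocusCone.

Variables (L : fieldType) (n d : nat) (lam : d.-tuple nat).
Hypothesis charL : [pchar L] =i pred0.
Hypothesis sum_lam : sumn lam = n.
Hypothesis lam_gt0 : forall i, (0 < tnth lam i)%N.

Local Notation params := (L^o * 'M[L]_(d, 2))%type.
Implicit Types (v w : params) (F : {mpoly L[n.+1]}).

Definition param_linear v (i : 'I_d) : {poly L} := linear_poly (v.2 i 0, v.2 i 1).

Definition param_form v : {poly L} :=
  v.1 *: \prod_i param_linear v i ^+ tnth lam i.

(** The common factor of all first order deformations of [param_form v]; called
    [P] in the introduction. *)
Definition reduced_form v : {poly L} :=
  \prod_i param_linear v i ^+ (tnth lam i).-1.

Definition cone_point v : 'rV[L]_n.+1 := poly_rV (param_form v).

Lemma sum_tnth_lam : (\sum_i tnth lam i = n)%N.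
Proof. by rewrite -sum_lam sumnE big_tuple. Qed.

Lemma le_size_lam : (d <= n)%N.
Proof.
rewrite -sum_tnth_lam -[leqLHS]card_ord -sum1_card; apply: leq_sum => i _.
exact: lam_gt0.
Qed.

Lemma sum_pred_tnth_lam : (\sum_i (tnth lam i).-1 = n - d)%N.
Proof.
have -> : (n = \sum_i (tnth lam i).-1 + d)%N.
  rewrite -[d in (_ + d)%N]card_ord -sum1_card -big_split -sum_tnth_lam /=.
  by apply: eq_bigr => i _; rewrite addn1 prednK.
by rewrite addnK.
Qed.

Lemma size_param_form v : (size (param_form v) <= n.+1)%N.
Proof.
apply: leq_trans (size_scale_leq _ _) _; rewrite -sum_tnth_lam.
exact: size_prod_linear_poly.
Qed.

Lemma size_reduced_form v : (size (reduced_form v) <= (n - d).+1)%N.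
Proof. by rewrite -sum_pred_tnth_lam; apply: size_prod_linear_poly. Qed.

Lemma size_reduced_formM v (h : {poly L}) :
  (size h <= d.+1)%N -> (size (reduced_form v * h)%R <= n.+1)%N.
Proof.
move=> hd; apply: leq_trans (size_polyMleq _ _) _.
have := leq_add (size_reduced_form v) hd; rewrite addSn addnS subnK ?le_size_lam //.
by case: (_ + _)%N.
Qed.

Lemma rVpoly_cone_point v : rVpoly (cone_point v) = param_form v.
Proof. by rewrite poly_rV_K ?size_param_form. Qed.

Lemma cone_pointE v i : cone_point v 0 i = (param_form v)`_i.
Proof. by rewrite mxE. Qed.

Lemma poly_family_param_linear i : poly_family (param_linear^~ i).
Proof.
apply: poly_familyD => k.
  apply: (@eq_polynomial_fun _ _ (fun v => if k == 0%N then v.2 i 0 else 0)).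
    by move=> v; rewrite coefC.
  case: (k == 0%N); last exact: polynomial_fun_const.
  by apply: polynomial_fun_affine => a b t; rewrite !mxE.
apply: poly_familyZ; last exact: poly_family_const.
by apply: polynomial_fun_affine => a b t; rewrite !mxE.
Qed.

Lemma poly_family_param_form : poly_family param_form.
Proof.
apply: poly_familyZ; first exact: polynomial_fun_affine.
by apply: poly_family_prod => i; apply/poly_familyX/poly_family_param_linear.
Qed.

Lemma poly_family_reduced_form : poly_family reduced_form.
Proof. by apply: poly_family_prod => i; apply/poly_familyX/poly_family_param_linear. Qed.

Lemma polynomial_fun_cone_point i : polynomial_fun (fun v => cone_point v 0 i).
Proof.
by apply: eq_polynomial_fun (poly_family_param_form i) => v; rewrite cone_pointE.
Qed.

Lemma multiple_root_locus_cone_point (a : 'rV[L]_n.+1) :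
  multiple_root_locus lam a <-> a != 0 /\ exists v, a = cone_point v.
Proof.
rewrite multiple_root_locusP //; split=> [[a0 [c [u [u0 ea]]]]|[a0 [v ea]]]; split=> //.
  exists (c, \matrix_(i, j) (if j == 0 then (u i).1 else (u i).2)).
  rewrite -[LHS]rVpolyK ea; congr (poly_rV (_ *: _)).
  rewrite size_tuple; apply: eq_bigr => i _ /=.
  rewrite /param_linear !mxE /= -surjective_pairing (tnth_nth 0%N).
  by [].
exists v.1, (fun k => if insub k is Some i then (v.2 i 0, v.2 i 1) else (1, 0)).
have eF : rVpoly a = param_form v by rewrite ea rVpoly_cone_point.
split=> [k|].
  case: insubP => [i _ _|_]; last by rewrite xpair_eqE oner_eq0.
  rewrite -linear_poly_eq0; apply: contraNneq a0 => li0.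
  rewrite -(rVpolyK a) eF /param_form (bigD1 i) //= /param_linear li0 expr0n.
  by rewrite eqn0Ngt lam_gt0 mul0r scaler0 linear0.
rewrite eF size_tuple /param_form; congr (_ *: _); apply: eq_bigr => i _.
by rewrite valK (tnth_nth 0%N).
Qed.

Lemma coef_param_form_top :
  exists v, (param_form v)`_n != 0.
Proof.
exists (1, \matrix_(i, j) (j == 1)%:R); rewrite /param_form scale1r.
rewrite (eq_bigr (fun i => 'X^(tnth lam i))) => [|i _].
  by rewrite -(big_morph _ (exprD 'X) (expr0 'X)) sum_tnth_lam coefXn eqxx oner_eq0.
by rewrite /param_linear !mxE /linear_poly /= scale1r add0r.
Qed.

(** Some parameters give the zero vector, which represents no point; the density
    of the others shows that the equations also hold there. *)
Lemma vanishes_on_coneP F :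
  vanishes_on (multiple_root_locus lam) F <-> forall v, F.@[cone_point v 0] = 0.
Proof.
split=> [F0|F0 a]; last by case/multiple_root_locus_cone_point => _ [v ->].
apply: (polynomial_fun_density charL (poly_family_param_form n)).
- by apply: polynomial_fun_meval => i; apply: polynomial_fun_cone_point.
- exact: coef_param_form_top.
move=> v vn; apply: F0; apply/multiple_root_locus_cone_point; split; last by exists v.
apply: contraNneq vn => v0; rewrite -(cone_pointE v ord_max) v0.
by rewrite mxE.
Qed.

(** The tangent space defined by all equations of the cone, homogeneous or not;
    [tangent_spaceP] shows that the homogeneous ones suffice. *)
Definition cone_tangent (f x : 'rV[L]_n.+1) : Prop :=
  forall F, (forall v, F.@[cone_point v 0] = 0) ->
    \sum_(i < n.+1) (F^`M(i)).@[f 0] * x 0 i = 0.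

Lemma cone_tangent_comb f a x y :
  cone_tangent f x -> cone_tangent f y -> cone_tangent f (a *: x + y).
Proof.
move=> fx fy F F0; under eq_bigr do rewrite !mxE mulrDr mulrCA.
by rewrite big_split /= -mulr_sumr fx // fy // mulr0 addr0.
Qed.

Lemma cone_tangent0 f : cone_tangent f 0.
Proof. by move=> F _; apply: big1 => i _; rewrite mxE mulr0. Qed.

Lemma cone_tangentD f x y : cone_tangent f x -> cone_tangent f y -> cone_tangent f (x + y).
Proof. by move=> fx fy; rewrite -[x]scale1r; apply: cone_tangent_comb. Qed.

Lemma cone_tangentZ f a x : cone_tangent f x -> cone_tangent f (a *: x).
Proof. by move=> fx; rewrite -[_ *: x]addr0; apply: cone_tangent_comb (cone_tangent0 f). Qed.

Lemma meval_homog_scale (k : nat) F (c : L) (x : 'I_n.+1 -> L) :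
  F \is k.-homog -> F.@[fun i => c * x i] = c ^+ k * F.@[x].
Proof.
move=> /dhomogP homF; rewrite !mevalE mulr_sumr !big_seq; apply: eq_bigr => m mF.
rewrite mulrCA; congr (_ * _); under eq_bigr do rewrite exprMn.
rewrite big_split /=; congr (_ * _).
have /= <- := homF m mF; rewrite mdegE.
by rewrite -(big_morph _ (exprD c) (expr0 c)).
Qed.

Lemma scale_cone_point c v : exists w, cone_point w = c *: cone_point v.
Proof. by exists (c * v.1, v.2); rewrite /cone_point /param_form /= -scalerA linearZ. Qed.

(** The cone is invariant under scaling, and on a line through [0] the values of
    the homogeneous components are the coefficients of the restriction of [F]. *)
Lemma pihomog_vanishes_on_cone F k : (forall v, F.@[cone_point v 0] = 0) ->
  forall v, (pihomog mdeg k F).@[cone_point v 0] = 0.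
Proof.
move=> F0 v; pose q := \poly_(j < msize F) (pihomog mdeg j F).@[cone_point v 0].
have q0 : q = 0.
  apply/eqP/negPn/negP => /(pchar0_exists_nonroot charL)[t].
  have [w ew] := scale_cone_point t v.
  rewrite horner_poly; have := F0 w.
  rewrite {1}(@pihomog_partitionE _ _ mdeg (msize F) F) // raddf_sum /=.
  under eq_bigr => j _.
    rewrite ew (@meval_eq _ _ _ (fun i => t * cone_point v 0 i)); last by move=> i; rewrite mxE.
    rewrite (meval_homog_scale t _ (pihomogP mdeg j F)) mulrC.
  over.
  by move=> ->; rewrite eqxx.
have [kF|kF] := ltnP k (msize F).
  by have := congr1 (fun p : {poly L} => p`_k) q0; rewrite coef_poly kF coef0.
rewrite pihomogE big_seq_cond big_pred0 ?meval0 // => m; apply/negP => /andP[mF /eqP mk].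
by have := msize_mdeg_lt mF; rewrite mk ltnNge kF.
Qed.

Lemma tangent_spaceP f x :
  tangent_space (multiple_root_locus lam) f x <-> cone_tangent f x.
Proof.
split=> [fx F F0|fx k F _ /vanishes_on_coneP F0]; last exact: fx.
rewrite (@pihomog_partitionE _ _ mdeg (msize F) F) //.
under eq_bigr => i _.
  rewrite (raddf_sum (mderiv i)) (raddf_sum (meval _)) /= mulr_suml.
over.
rewrite exchange_big /=; apply: big1 => k _; apply: fx (pihomogP mdeg k F) _.
by apply/vanishes_on_coneP; apply: pihomog_vanishes_on_cone.
Qed.

Lemma cone_tangent_curve (a : 'I_n.+1 -> {poly L}) (f x : 'rV[L]_n.+1) :
  (forall t, exists v, forall i, (a i).[t] = cone_point v 0 i) ->
  (forall i, (a i)`_0 = f 0 i) -> (forall i, (a i)`_1 = x 0 i) ->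
  cone_tangent f x.
Proof.
move=> ha af ax F F0.
under eq_bigr do rewrite -ax -(meval_eq _ af).
apply: gradient_along_curve => // t; have [v hv] := ha t.
by rewrite (meval_eq _ hv) F0.
Qed.

Lemma cone_tangent_self v : cone_tangent (cone_point v) (cone_point v).
Proof.
apply: (@cone_tangent_curve (fun i => cone_point v 0 i *: (1 + 'X))) => [t|i|i].
- have [w ew] := scale_cone_point (1 + t) v; exists w => i.
  by rewrite ew [RHS]mxE hornerZ hornerD hornerX hornerC mulrC.
- by rewrite coefZ coefD coef1 coefX addr0 mulr1.
- by rewrite coefZ coefD coef1 coefX add0r mulr1.
Qed.

(** The derivative of the curve that adds the constant [t] to the [i]-th linear
    factor. *)
Lemma cone_tangent_root v i : cone_tangent (cone_point v)
  (poly_rV (v.1 *: (reduced_form v * \prod_(j | j != i) param_linear v j))).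
Proof.
pose A := v.1 *: \prod_(j | j != i) param_linear v j ^+ tnth lam j.
pose l := param_linear v i; pose k := tnth lam i.
have AE w : w.1 = v.1 -> (forall j, j != i -> param_linear w j = param_linear v j) ->
    param_form w = A * param_linear w i ^+ k.
  move=> w1 wl; rewrite /param_form (bigD1 i) //= w1 mulrC scalerAl; congr (_ *: _ * _).
  by apply: eq_bigr => j ji; rewrite wl.
have -> : v.1 *: (reduced_form v * \prod_(j | j != i) param_linear v j) = A * l ^+ k.-1.
  rewrite /reduced_form (bigD1 i) //= -mulrA -big_split /= mulrC scalerAl.
  congr (_ *: _ * _); apply: eq_bigr => j ji.
  by rewrite -exprSr prednK.
have k_neq0 : (k%:R : L) != 0 by rewrite pchar0_natr_eq0 // -lt0n lam_gt0.
rewrite -[poly_rV _]scale1r -(mulVf k_neq0) -scalerA; apply: cone_tangentZ.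
(* The coordinates of the curve, expanded by the binomial formula. *)
pose a (m : 'I_n.+1) := \poly_(r < k.+1) ((A * l ^+ (k - r))`_m *+ 'C(k, r)).
apply: (@cone_tangent_curve a) => [t|m|m].
- pose w : params := (v.1, v.2 + t *: delta_mx i 0); exists w => m.
  have wi : param_linear w i = l + t%:P.
    rewrite /param_linear /l /param_linear /linear_poly /= !mxE !eqxx /= mulr1 mulr0 addr0.
    by rewrite polyCD addrAC.
  rewrite cone_pointE (AE w) //; last first.
    by move=> j ji; rewrite /param_linear !mxE (negbTE ji) /= !mulr0 !addr0.
  rewrite wi exprDn horner_poly mulr_sumr coef_sum; apply: eq_bigr => r _.
  rewrite mulrnAr coefMn mulrnAl; congr (_ *+ _).
  by rewrite mulrA -rmorphXn /= coefMC.
- by rewrite coef_poly /= bin0 mulr1n subn0 cone_pointE (AE v).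
- by rewrite coef_poly ltnS lam_gt0 bin1 subn1 !mxE mulr_natl.
Qed.

(** The product of the coefficients of [y] in the linear factors and of the
    resultants of all ordered pairs of them. *)
Definition distinct_roots_fun v : L :=
  \prod_i v.2 i 1 * \prod_i \prod_(j | j != i) (v.2 i 0 * v.2 j 1 - v.2 j 0 * v.2 i 1).

Lemma exists_distinct_roots : exists v : params, distinct_roots_fun v != 0.
Proof.
exists (0, \matrix_(i, j) (if j == 0 then i%:R else 1)).
rewrite mulf_neq0 //; first by apply/prodf_neq0 => i _; rewrite mxE oner_eq0.
apply/prodf_neq0 => i _; apply/prodf_neq0 => j ji; rewrite !mxE /= !mulr1 subr_eq0.
by rewrite (inj_eq (pchar0_natr_inj charL)) eq_sym.
Qed.

Lemma polynomial_fun_entry (i : 'I_d) (j : 'I_2) : polynomial_fun (fun v : params => v.2 i j).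
Proof. by apply: polynomial_fun_affine => a b t; rewrite !mxE. Qed.

Lemma polynomial_fun_distinct_roots : polynomial_fun distinct_roots_fun.
Proof.
apply: polynomial_funM; apply: polynomial_fun_prod => i; first exact: polynomial_fun_entry.
apply: polynomial_fun_prod => j; apply: polynomial_funD.
  by apply: polynomial_funM; apply: polynomial_fun_entry.
by apply/polynomial_funN/polynomial_funM; apply: polynomial_fun_entry.
Qed.

Lemma distinct_rootsP v : distinct_roots_fun v != 0 ->
  [/\ forall i, v.2 i 1 != 0,
      injective (fun i => - (v.2 i 0 / v.2 i 1)) &
      forall i, param_linear v i = v.2 i 1 *: ('X - (- (v.2 i 0 / v.2 i 1))%:P)].
Proof.
rewrite mulf_eq0 negb_or => /andP[/prodf_neq0 v1 /prodf_neq0 v2].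
have v10 i : v.2 i 1 != 0 by apply: v1.
split=> // [i j /oppr_inj e|i].
  apply/eqP; apply/negPn/negP => ij; have /prodf_neq0/(_ i) := v2 j isT.
  move=> /(_ ij); rewrite subr_eq0 => /negP; apply; apply/eqP.
  by apply: (mulIf (invr_neq0 (v10 i))); apply: (mulIf (invr_neq0 (v10 j)));
    rewrite mulfK // mulrAC mulfK // e mulrAC.
rewrite polyCN opprK scalerDr [LHS]addrC; congr (_ + _).
by rewrite -mul_polyC -polyCM mulrC divfK.
Qed.

(** For distinct roots, moving them and rescaling gives the whole space of
    multiples of the reduced form, by Lagrange interpolation.  The equations of
    the tangent space depend polynomially on the point, so the inclusion
    persists where roots collide. *)
Lemma cone_tangent_reduced_multiple v (h : {poly L}) : (size h <= d.+1)%N ->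
  cone_tangent (cone_point v) (poly_rV (v.1 *: (reduced_form v * h))).
Proof.
move=> hd F F0; apply: (polynomial_fun_density charL polynomial_fun_distinct_roots
  (Q := fun v => \sum_(i < n.+1) (F^`M(i)).@[cone_point v 0]
                  * (poly_rV (v.1 *: (reduced_form v * h)) : 'rV_n.+1) 0 i)).
- apply: polynomial_fun_sum => i; apply: polynomial_funM.
    by apply: polynomial_fun_meval => j; apply: polynomial_fun_cone_point.
  apply: (@eq_polynomial_fun _ _ (fun v => (v.1 *: (reduced_form v * h))`_i)).
    by move=> w; rewrite mxE.
  apply: poly_familyZ; first exact: polynomial_fun_affine.
  by apply: poly_familyM; [apply: poly_family_reduced_form | apply: poly_family_const].
- exact: exists_distinct_roots.
move=> {}v /distinct_rootsP[v10 rho_inj vl].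
suff : cone_tangent (cone_point v) (poly_rV (v.1 *: (reduced_form v * h))) by apply.
have [e [c ->]] := lagrange_span vl v10 rho_inj hd.
rewrite mulrDr scalerDr linearD /=; apply: cone_tangentD.
  rewrite -scalerAr scalerA mulrC -scalerA linearZ /=; apply: cone_tangentZ.
  have -> : v.1 *: (reduced_form v * \prod_i param_linear v i) = param_form v.
    rewrite /reduced_form -big_split /=; congr (_ *: _); apply: eq_bigr => i _.
    by rewrite -exprSr prednK.
  exact: cone_tangent_self.
rewrite mulr_sumr scaler_sumr linear_sum /=; apply: big_ind => [|x y|i _].
- exact: cone_tangent0.
- exact: cone_tangentD.
rewrite -scalerAr scalerA mulrC -scalerA linearZ /=; apply: cone_tangentZ.
exact: cone_tangent_root.
Qed.

End RootLocusCone.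

(** * Dimension of the cone and generic smoothness *)

(** [p] is invertible modulo ['X^m]. *)
Lemma exists_mul_prefix (L : fieldType) (m : nat) (p q : {poly L}) : p`_0 != 0 ->
  exists2 h : {poly L}, (size h <= m)%N & forall k, (k < m)%N -> (p * h)`_k = q`_k.
Proof.
move=> p0; have cop : coprimep p 'X^m.
  by apply: coprimep_expr; rewrite coprimepX /root horner_coef0.
have /Bezout_eq1_coprimepP[[u w] /= uw] := cop.
exists ((u * q) %% 'X^m) => [|k km].
  by rewrite -ltnS -(size_polyXn L m) ltn_modp monic_neq0 ?monicXn.
have e : p * ((u * q) %% 'X^m) = q - (w * q + p * ((u * q) %/ 'X^m)) * 'X^m.
  apply/eqP; rewrite eq_sym subr_eq; apply/eqP.
  rewrite -[LHS]mul1r -uw mulrDl [w * _ * q]mulrAC [u * p]mulrC -[p * u * q]mulrA.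
  rewrite {1}(divp_eq (u * q) 'X^m) mulrDr mulrA [_ + p * (_ %% _)]addrC -addrA.
  by rewrite [X in _ + X]addrC -mulrDl.
by rewrite e coefB coefMXn km subr0.
Qed.

Lemma size_rVpoly (L : fieldType) (m : nat) (u : 'rV[L]_m) : (size (rVpoly u) <= m)%N.
Proof. by rewrite /rVpoly; apply: size_poly. Qed.

Section RootLocusDimension.

Variables (L : fieldType) (n d : nat) (lam : d.-tuple nat).
Hypothesis charL : [pchar L] =i pred0.
Hypothesis sum_lam : sumn lam = n.
Hypothesis lam_gt0 : forall i, (0 < tnth lam i)%N.

Local Notation params := (L^o * 'M[L]_(d, 2))%type.
Local Notation cone_point := (cone_point n lam).
Implicit Types (v w : params) (F : {mpoly L[n.+1]}).

(** On the chart where all linear factors are monic in [y], the cone is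
    parametrized by as many coordinates as its dimension. *)
Definition chart_params (r : 'I_d.+1 -> L) : params :=
  (r ord0, \matrix_(i, j) (if j == 0 then r (lift ord0 i) else 1)).

Definition chart_coord (i : 'I_n.+1) : {mpoly L[d.+1]} :=
  ('X_ord0 *: \prod_(k < d) (('X_(lift ord0 k))%:P + 'X) ^+ tnth lam k
     : {poly {mpoly L[d.+1]}})`_i.

Lemma meval_chart_coord r i : (chart_coord i).@[r] = cone_point (chart_params r) 0 i.
Proof.
rewrite /chart_coord -(coef_map (meval r)) -mul_polyC rmorphM /= map_polyC /= mevalXU.
rewrite cone_pointE /param_form mul_polyC; congr (polyseq (_ *: _))`_i.
rewrite rmorph_prod; apply: eq_bigr => k _ /=.
rewrite rmorphXn rmorphD /= map_polyX map_polyC /= mevalXU.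
by rewrite /param_linear !mxE /linear_poly /= scale1r.
Qed.

(** Where all linear factors involve [y], they can be made monic in [y] at the
    cost of rescaling the form. *)
Lemma chart_density F :
  (forall r, F.@[cone_point (chart_params r) 0] = 0) -> forall v, F.@[cone_point v 0] = 0.
Proof.
move=> F0; apply: (polynomial_fun_density charL (W := fun v => \prod_i v.2 i 1)).
- by apply: polynomial_fun_prod => i; apply: polynomial_fun_entry.
- by apply: polynomial_fun_meval => i; apply: polynomial_fun_cone_point.
- exists (0, \matrix_(i, j) 1); apply/prodf_neq0 => i _.
  by rewrite mxE oner_eq0.
move=> v /prodf_neq0 v0; rewrite -(F0 (fun k => if unlift ord0 k is Some i
   then v.2 i 0 / v.2 i 1 else v.1 * \prod_i v.2 i 1 ^+ tnth lam i)).
apply: meval_eq => k; congr (poly_rV _ 0 k).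
rewrite /param_form /= unlift_none -scalerA; congr (_ *: _).
rewrite -scaler_prod; apply: eq_bigr => i _; rewrite -exprZn; congr (_ ^+ _).
rewrite /param_linear !mxE /= liftK /linear_poly /= scalerDr scale1r; congr (_ + _).
by rewrite -mul_polyC -polyCM mulrC divfK ?v0.
Qed.

(** Pulling back to the chart leaves only [d.+1] variables. *)
Lemma alg_dependent_on_cone (s : nat) (G : s.-tuple {mpoly L[n.+1]}) : (d.+1 < s)%N ->
  exists2 P : {mpoly L[s]}, P != 0 & forall v, (P \mPo G).@[cone_point v 0] = 0.
Proof.
move=> ds.
have [P P0 PG] := mpoly_alg_dependent
  [tuple tnth G k \mPo [tuple chart_coord i | i < n.+1] | k < s] ds.
exists P => //; apply: chart_density => r.
have := congr1 (meval r) PG; rewrite meval0 comp_mpoly_meval => <-.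
rewrite comp_mpoly_meval; apply: meval_eq => k.
rewrite tnth_mktuple comp_mpoly_meval; apply: meval_eq => i.
by rewrite tnth_mktuple meval_chart_coord.
Qed.

Lemma cone_tangent_coords (s : nat) (sigma : 'I_s -> 'I_n.+1) (P : {mpoly L[s]}) f x :
  (forall v, P.@[fun k => cone_point v 0 (sigma k)] = 0) -> cone_tangent lam f x ->
  \sum_k (P^`M(k)).@[fun k => f 0 (sigma k)] * x 0 (sigma k) = 0.
Proof.
move=> P0 fx; pose H := [tuple 'X_(sigma k) : {mpoly L[n.+1]} | k < s].
have evalH (Q : {mpoly L[s]}) (y : 'rV[L]_n.+1) :
    (Q \mPo H).@[y 0] = Q.@[fun k => y 0 (sigma k)].
  by rewrite comp_mpoly_meval; apply: meval_eq => k; rewrite tnth_mktuple mevalXU.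
rewrite -[RHS](fx (P \mPo H)) => [|v]; last by rewrite evalH.
under [RHS]eq_bigr => i _.
  rewrite mderiv_comp_mpoly raddf_sum /= mulr_suml.
over.
rewrite exchange_big /=; apply: eq_bigr => k _.
rewrite (bigD1 (sigma k)) //= big1 ?addr0 => [|i ik].
  rewrite tnth_mktuple mderivX mnm1E eqxx scale1r mevalM evalH.
  by rewrite -[X in 'X_[X - _]]addm0 addmC addmK mpolyX0 meval1 mulr1.
by rewrite tnth_mktuple mderivX mnm1E eq_sym (negbTE ik) scale0r mulr0 meval0 mul0r.
Qed.

Definition low_coord (k : 'I_d.+1) : 'I_n.+1 := inord k.

Lemma low_coordE k : low_coord k = k :> nat.
Proof. by rewrite inordK // ltnS (leq_trans _ (le_size_lam sum_lam lam_gt0)) // -ltnS. Qed.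

(** Where no multiple root lies at [y = 0], the reduced form is invertible modulo
    ['X^d.+1], so the first coordinates of its multiples are arbitrary. *)
Lemma exists_tangent_prefix v (x : 'I_d.+1 -> L) :
  v.1 * (reduced_form lam v)`_0 != 0 ->
  exists2 h : {poly L}, (size h <= d.+1)%N &
    forall k, (poly_rV (v.1 *: (reduced_form lam v * h)) : 'rV_n.+1) 0 (low_coord k) = x k.
Proof.
rewrite mulf_eq0 negb_or => /andP[v1 r0].
have [h hd hx] := exists_mul_prefix d.+1 (v.1^-1 *: rVpoly (\row_k x k)) r0.
exists h => // k; rewrite mxE coefZ low_coordE hx // coefZ mulrA divff // mul1r.
by rewrite coef_rVpoly_ord mxE.
Qed.

Lemma exists_prefix_params : exists v, v.1 * (reduced_form lam v)`_0 != 0.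
Proof.
exists (1, \matrix_(i, j) (j == 0)%:R).
rewrite mul1r /reduced_form big1 ?coef1 ?oner_eq0 // => i _.
by rewrite /param_linear !mxE /linear_poly /= scale0r addr0 expr1n.
Qed.

Lemma polynomial_fun_prefix : polynomial_fun (fun v => v.1 * (reduced_form lam v)`_0).
Proof.
apply: polynomial_funM; first exact: polynomial_fun_affine.
exact: poly_family_reduced_form.
Qed.

(** The polynomials in the first [d.+1] coordinates that vanish on the cone are
    stable under derivation, since the first coordinates of tangent vectors are
    arbitrary at a general point. *)
Lemma low_coords_alg_independent (P : {mpoly L[d.+1]}) :
  (forall v, P.@[fun k => cone_point v 0 (low_coord k)] = 0) -> P = 0.
Proof.
apply: (deriv_stable_mpoly_eq0 (I := fun P =>
  forall v, P.@[fun k => cone_point v 0 (low_coord k)] = 0)) => // [c c0|{}P k P0].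
  by have := c0 0; rewrite mevalC.
apply: (polynomial_fun_density charL polynomial_fun_prefix _ exists_prefix_params).
  by apply: polynomial_fun_meval => i; apply: polynomial_fun_cone_point.
move=> v /(exists_tangent_prefix (fun j => (j == k)%:R))[h hd hx].
have := cone_tangent_coords P0 (cone_tangent_reduced_multiple charL lam_gt0 v hd).
rewrite (bigD1 k) //= hx eqxx mulr1 big1 ?addr0 // => j jk.
by rewrite hx (negbTE jk) mulr0.
Qed.

Definition low_coord_or (i : 'I_n.+1) (k : 'I_d.+2) : 'I_n.+1 :=
  if unlift ord0 k is Some k' then low_coord k' else i.

(** Each coordinate satisfies an algebraic equation over the first [d.+1] ones
    that is separable: otherwise the ideal of all such equations would be stable
    under derivation, hence zero. *)
Lemma exists_separable_equation (i : 'I_n.+1) : exists P : {mpoly L[d.+2]},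
  (forall v, P.@[fun k => cone_point v 0 (low_coord_or i k)] = 0) /\
  (exists v, (P^`M(ord0)).@[fun k => cone_point v 0 (low_coord_or i k)] != 0).
Proof.
apply: NNPP => noP.
have [//|P P_neq0 P0] := @alg_dependent_on_cone d.+2 [tuple 'X_(low_coord_or i k) | k < d.+2].
case/negP: P_neq0; apply/eqP.
apply: (deriv_stable_mpoly_eq0 (I := fun P =>
  forall v, P.@[fun k => cone_point v 0 (low_coord_or i k)] = 0)) => //; last first.
- move=> v; rewrite -[RHS](P0 v) comp_mpoly_meval; apply: meval_eq => k.
  by rewrite tnth_mktuple mevalXU.
- move=> {P0}P k P0.
  have dP0 v : (P^`M(ord0)).@[fun k => cone_point v 0 (low_coord_or i k)] = 0.
    by apply/eqP/negPn/negP => Pv; apply: noP; exists P; split=> //; exists v.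
  case: (unliftP ord0 k) => [k' -> | -> //].
  apply: (polynomial_fun_density charL polynomial_fun_prefix _ exists_prefix_params).
    by apply: polynomial_fun_meval => j; apply: polynomial_fun_cone_point.
  move=> v /(exists_tangent_prefix (fun j => (j == k')%:R))[h hd hx].
  have := cone_tangent_coords P0 (cone_tangent_reduced_multiple charL lam_gt0 v hd).
  rewrite big_ord_recl dP0 mul0r add0r.
  rewrite (bigD1 k') //= {2}/low_coord_or liftK hx eqxx mulr1 big1 ?addr0 // => j jk.
  by rewrite {2}/low_coord_or liftK hx (negbTE jk) mulr0.
by move=> c c0; have := c0 0; rewrite mevalC.
Qed.

Lemma has_cone_dim_root_locus : has_cone_dim (@multiple_root_locus L n lam) d.+1.
Proof.
split=> [|s G indG].
  exists [tuple 'X_(low_coord k) | k < d.+1] => P /(vanishes_on_coneP charL sum_lam lam_gt0) P0.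
  apply: low_coords_alg_independent => v; rewrite -[RHS](P0 v) comp_mpoly_meval.
  by apply: meval_eq => k; rewrite tnth_mktuple mevalXU.
rewrite leqNgt; apply/negP => ds; have [P P_neq0 P0] := alg_dependent_on_cone G ds.
by case/negP: P_neq0; apply/eqP/indG/(vanishes_on_coneP charL sum_lam lam_gt0).
Qed.

(** Multiplication by the reduced form is injective. *)
Lemma reduced_multiples_vspace v : v.1 != 0 -> reduced_form lam v != 0 ->
  exists T : {vspace 'rV[L]_n.+1}, \dim T = d.+1 /\
    forall x, x \in T <-> exists2 h : {poly L}, (size h <= d.+1)%N &
      x = poly_rV (v.1 *: (reduced_form lam v * h)).
Proof.
move=> v1 r0; pose f : {linear 'rV[L]_d.+1 -> 'rV[L]_n.+1} :=
  poly_rV \o ((v.1 *: reduced_form lam v) \*o rVpoly).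
have fE u : linfun f u = poly_rV (v.1 *: (reduced_form lam v * rVpoly u)).
  by rewrite lfunE /= -scalerAl.
have ker0 : lker (linfun f) = 0%VS.
  apply/eqP/lker0P => u w; rewrite !fE => /(congr1 rVpoly).
  have sz (u' : 'rV_d.+1) : (size (v.1 *: (reduced_form lam v * rVpoly u')) <= n.+1)%N.
    apply: leq_trans (size_scale_leq _ _) _.
    by apply: (size_reduced_formM sum_lam lam_gt0 _ (size_rVpoly _)).
  by rewrite !poly_rV_K // => /(scalerI v1)/(mulfI r0)/(can_inj rVpolyK).
exists (limg (linfun f)); split.
  by rewrite limg_dim_eq ?ker0 ?capv0 // dimvf /dim /= mul1n.
move=> x; split=> [/memv_imgP[u _ ->]|[h hd ->]].
  by exists (rVpoly u); rewrite ?fE ?size_rVpoly.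
by apply/memv_imgP; exists (poly_rV h); rewrite ?memvf // fE poly_rV_K.
Qed.

(** At a general point the separable equations leave only the first coordinates
    of a tangent vector free, so the tangent space is no larger than the space
    of multiples of the reduced form, and its dimension is that of the cone. *)
Lemma generic_smooth_point : exists W : params -> L,
  [/\ polynomial_fun W, exists v, W v != 0 & forall v, W v != 0 ->
    smooth_point (@multiple_root_locus L n lam) (cone_point v) /\
    forall x, tangent_space (@multiple_root_locus L n lam) (cone_point v) x ->
      exists2 h : {poly L}, (size h <= d.+1)%N & x = poly_rV (v.1 *: (reduced_form lam v * h))].
Proof.
have [P hP] := fin_all_exists exists_separable_equation.
pose W1 v := \prod_i ((P i)^`M(ord0)).@[fun k => cone_point v 0 (low_coord_or i k)].
have pW1 : polynomial_fun W1.
  apply: polynomial_fun_prod => i; apply: polynomial_fun_meval => k.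
  exact: polynomial_fun_cone_point.
pose W2 v := v.1 * (reduced_form lam v)`_0 * (param_form lam v)`_n.
have pW2 : polynomial_fun W2.
  exact: polynomial_funM polynomial_fun_prefix (poly_family_param_form _ _).
exists (fun v => W1 v * W2 v); split.
- exact: polynomial_funM.
- apply: polynomial_fun_common_nonzero => //.
    apply: polynomial_fun_prod_common_nonzero => // i; last by have [] := hP i.
    by apply: polynomial_fun_meval => k; apply: polynomial_fun_cone_point.
  apply: polynomial_fun_common_nonzero => //.
  + exact: polynomial_fun_prefix.
  + exact: poly_family_param_form.
  + exact: exists_prefix_params.
  + exact: coef_param_form_top.
move=> v; rewrite mulf_eq0 negb_or => /andP[/prodf_neq0 Wi].
rewrite mulf_eq0 negb_or => /andP[Wp Wn].
have tangent x : tangent_space (@multiple_root_locus L n lam) (cone_point v) x ->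
    exists2 h : {poly L}, (size h <= d.+1)%N & x = poly_rV (v.1 *: (reduced_form lam v * h)).
  move=> /(tangent_spaceP charL sum_lam lam_gt0) Tx.
  have [h hd hx] := exists_tangent_prefix (fun k => x 0 (low_coord k)) Wp.
  exists h => //; apply/eqP; rewrite -subr_eq0; apply/eqP/rowP => i.
  set y := x - _; rewrite [RHS]mxE.
  have Ty : cone_tangent lam (cone_point v) y.
    rewrite /y -scaleN1r addrC; apply: cone_tangent_comb => //.
    exact: cone_tangent_reduced_multiple.
  have [Pi0 _] := hP i; have := cone_tangent_coords Pi0 Ty.
  rewrite big_ord_recl big1 ?addr0 => [/eqP|k _]; last first.
    by rewrite {2}/low_coord_or liftK /y mxE [X in _ + X]mxE hx subrr mulr0.
  rewrite {2}/low_coord_or unlift_none mulf_eq0 => /orP[e|/eqP //].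
  by have := Wi i isT; rewrite e.
split=> //; split.
  apply/(multiple_root_locus_cone_point sum_lam lam_gt0); split; last by exists v.
  apply: contraNneq Wn => v0; rewrite -(cone_pointE lam v ord_max) v0.
  by rewrite mxE.
have [v1 r0] : v.1 != 0 /\ reduced_form lam v != 0.
  split; apply: contraNneq Wp => ->; first by rewrite mul0r.
  by rewrite coef0 mulr0.
have [T [dimT memT]] := reduced_multiples_vspace v1 r0.
exists T; rewrite dimT; split; last exact: has_cone_dim_root_locus.
move=> x; split=> [/memT[h hd ->]|/tangent/memT //].
apply/(tangent_spaceP charL sum_lam lam_gt0).
exact: cone_tangent_reduced_multiple.
Qed.

End RootLocusDimension.

(** * Apolarity *)

Section Apolarity.

Variables (L : fieldType) (n : nat).
Hypothesis charL : [pchar L] =i pred0.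
Implicit Types (f g : 'rV[L]_n.+1) (rho : L).

Lemma pairingZDr a f g1 g2 : pairing f (a *: g1 + g2) = a * pairing f g1 + pairing f g2.
Proof.
rewrite !pairingE mulr_sumr -big_split /=; apply: eq_bigr => i _.
by rewrite !mxE mulrDr mulrDl [f 0 i * (a * _)]mulrCA -!mulrA.
Qed.

Lemma pairing0r f : pairing f 0 = 0.
Proof. by rewrite pairingE big1 // => i _; rewrite mxE mulr0 mul0r. Qed.

Lemma pairing_sumr (I : Type) (r : seq I) f (G : I -> 'rV[L]_n.+1) :
  pairing f (\sum_(i <- r) G i) = \sum_(i <- r) pairing f (G i).
Proof.
elim: r => [|i r IHr]; first by rewrite !big_nil pairing0r.
by rewrite !big_cons -IHr -[G i]scale1r pairingZDr mul1r scale1r.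
Qed.

Lemma pairingZr a f g : pairing f (a *: g) = a * pairing f g.
Proof. by rewrite -[_ *: g]addr0 pairingZDr pairing0r addr0. Qed.

Lemma pairingZl a f g : pairing (a *: f) g = a * pairing f g.
Proof.
by rewrite !pairingE mulr_sumr; apply: eq_bigr => i _; rewrite !mxE -!mulrA.
Qed.

Lemma coef_exp_linear rho m j :
  ((1 + rho *: 'X) ^+ m : {poly L})`_j = rho ^+ j *+ 'C(m, j).
Proof.
rewrite exprDn coef_sum; have [jm|mj] := leqP j m; last first.
  rewrite bin_small // mulr0n big1 // => i _.
  rewrite expr1n mul1r coefMn exprZn coefZ coefXn; case: eqP => [ji|]; last by rewrite mulr0 mul0rn.
  by rewrite ji ltnNge -ltnS ltn_ord in mj.
rewrite (bigD1 (Ordinal (jm : j < m.+1)%N)) //= big1 ?addr0 => [|i ij].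
  by rewrite expr1n mul1r coefMn exprZn coefZ coefXn eqxx mulr1.
rewrite expr1n mul1r coefMn exprZn coefZ coefXn; case: eqP => [ji|]; last by rewrite mulr0 mul0rn.
by case/eqP: ij; apply/val_inj; rewrite /= ji.
Qed.

Lemma coef_exp_shift rho i k :
  (('X + rho%:P) ^+ i : {poly L})`_k = rho ^+ (i - k) *+ 'C(i, k).
Proof.
rewrite addrC exprDn coef_sum; have [ki|ik] := leqP k i; last first.
  rewrite bin_small // mulr0n big1 // => j _.
  rewrite coefMn -rmorphXn /= coefCM coefXn; case: eqP => [kj|]; last by rewrite mulr0 mul0rn.
  by rewrite kj ltnNge -ltnS ltn_ord in ik.
rewrite (bigD1 (Ordinal (ki : k < i.+1)%N)) //= big1 ?addr0 => [|j jk].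
  by rewrite coefMn -rmorphXn /= coefCM coefXn eqxx mulr1.
rewrite coefMn -rmorphXn /= coefCM coefXn; case: eqP => [kj|]; last by rewrite mulr0 mul0rn.
by case/eqP: jk; apply/val_inj; rewrite /= kj.
Qed.

Lemma apolar_factorials i k : (k <= i <= n)%N ->
  ('C(n - k, i - k) * (i`! * (n - i)`!) = k`! * (n - k)`! * 'C(i, k))%N.
Proof.
case/andP => ki ik; apply/eqP; rewrite -(eqn_pmul2r (fact_gt0 (i - k))); apply/eqP.
have e1 : ('C(n - k, i - k) * ((i - k)`! * (n - i)`!) = (n - k)`!)%N.
  have -> : (n - i = n - k - (i - k))%N by rewrite subnBA // subnK ?(leq_trans ki ik).
  by rewrite bin_fact // leq_sub2r.
have e2 := bin_fact ki.
transitivity (('C(n - k, i - k) * ((i - k)`! * (n - i)`!)) * i`!)%N.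
  by rewrite -!mulnA; congr (_ * _)%N; rewrite mulnC [((n - i)`! * _)%N]mulnC -mulnA.
rewrite e1 -e2 [(k`! * (n - k)`!)%N]mulnC -!mulnA; congr (_ * _)%N.
by rewrite mulnCA.
Qed.

(** Powers of [1 + rho X] represent evaluation at [rho], and its products with
    powers of [X] represent the Taylor coefficients there. *)
Lemma pairing_taylor rho k f : (k <= n)%N ->
  pairing f (poly_rV ((1 + rho *: 'X) ^+ (n - k) * 'X^k)) =
  (n`!%:R)^-1 * (k`! * (n - k)`!)%:R * (rVpoly f \Po ('X + rho%:P))`_k.
Proof.
move=> kn; rewrite pairingE rVpolyE linear_sum /= coef_sum mulr_sumr.
apply: eq_bigr => i _; rewrite mxE coefMXn linearZ /= comp_Xn_poly coefZ coef_exp_shift.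
case: ltnP => [ik|ki]; first by rewrite bin_small // mulr0n !mulr0 mul0r.
rewrite coef_exp_linear ![f 0 i * (_ *+ _)]mulrnAr [LHS]mulrnAl [RHS]mulrnAr.
rewrite -[LHS]mulr_natr -[RHS]mulr_natr [_ * (f 0 i * _)]mulrC -!mulrA.
congr (_ * (_ * (_ * _))).
rewrite -!natrM; congr _%:R; rewrite mulnC.
by rewrite apolar_factorials // ki -ltnS ltn_ord.
Qed.

Lemma dvdp_exp_XsubC rho a (p : {poly L}) :
  (forall k, (k < a)%N -> (p \Po ('X + rho%:P))`_k = 0) -> ('X - rho%:P) ^+ a %| p.
Proof.
move=> p0; pose q := p \Po ('X + rho%:P).
have eq : q = drop_poly a q * 'X^a.
  rewrite -{1}(poly_take_drop a q) (_ : take_poly a q = 0) ?add0r //.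
  by apply/polyP => k; rewrite coef_take_poly coef0; case: ltnP => // /p0.
rewrite -(comp_polyXaddC_K p rho) -/q eq rmorphM /= comp_Xn_poly.
exact: dvdp_mulIr.
Qed.

Lemma coef_shift_exp_XsubC rho a k (w : {poly L}) : (k < a)%N ->
  ((('X - rho%:P) ^+ a * w) \Po ('X + rho%:P))`_k = 0.
Proof.
move=> ka; rewrite rmorphM rmorphXn /= comp_polyB comp_polyX comp_polyC addrK.
by rewrite mulrC coefMXn ka.
Qed.

(** The multiples of [(1 + rho X)^(n-a+1)] are spanned by the forms representing
    the first [a] Taylor coefficients at [rho]: expand the powers of [X] in the
    cofactor using [1 = (1 + rho X) - rho X]. *)
Lemma orthogonal_taylor_span rho a f : (a <= n.+1)%N ->
  (forall k, (k < a)%N -> pairing f (poly_rV ((1 + rho *: 'X) ^+ (n - k) * 'X^k)) = 0) ->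
  forall h : {poly L}, (size h <= a)%N ->
    pairing f (poly_rV ((1 + rho *: 'X) ^+ (n - a.-1) * h)) = 0.
Proof.
move=> an f0.
have mon i j : (j <= i < a)%N -> pairing f (poly_rV ((1 + rho *: 'X) ^+ (n - i) * 'X^j)) = 0.
  move: {2}(i - j)%N (leqnn (i - j)) => m; elim: m i j => [|m IHm] i j ijm /andP[ji ia].
    have -> : j = i by apply/eqP; rewrite eqn_leq ji -subn_eq0 -leqn0.
    exact: f0.
  have [ij|ij] := eqVneq i j; first by rewrite -ij; apply: f0.
  have {ij} ji' : (j < i)%N by rewrite ltn_neqAle eq_sym ij.
  case: i ji' ji ia ijm => // i ji' _ ia ijm.
  pose l : {poly L} := 1 + rho *: 'X.
  have e : l ^+ (n - i.+1) * 'X^j =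
      (- rho) *: (l ^+ (n - i.+1) * 'X^(j.+1)) + l ^+ (n - i) * 'X^j.
    have -> : (n - i = (n - i.+1).+1)%N by rewrite subnSK // -ltnS (leq_trans ia).
    rewrite (exprS l) {3}/l mulrDl mul1r mulrDl addrCA -!scalerAl -['X * _ * _]mulrA.
    by rewrite ['X * (_ * _)]mulrCA -exprS scaleNr addNr addr0.
  have ijm' : (i - j <= m)%N by rewrite -ltnS -subSn.
  rewrite e linearP /= pairingZDr (IHm i.+1 j.+1) ?subSS ?ji' //.
  by rewrite mulr0 add0r IHm // -ltnS ji' ltnW.
case: a an f0 mon => [|a] an f0 mon h ha.
  by move: ha; rewrite leqn0 size_poly_eq0 => /eqP->; rewrite mulr0 linear0 pairing0r.
rewrite -[h]coefK poly_def mulr_sumr linear_sum pairing_sumr; apply: big1 => j _.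
rewrite -scalerAr linearZ /= pairingZr mon ?mulr0 // ltnSn andbT.
by rewrite -ltnS (leq_trans (ltn_ord j)).
Qed.

Lemma dvdp_prod_exp_XsubC (d : nat) (rho : 'I_d -> L) (a : 'I_d -> nat) (p : {poly L}) :
  injective rho -> (forall i, ('X - (rho i)%:P) ^+ a i %| p) ->
  \prod_i ('X - (rho i)%:P) ^+ a i %| p.
Proof.
move=> rho_inj dvd; have : uniq (index_enum 'I_d) := index_enum_uniq _.
elim: (index_enum _) => [|i r IHr] /=; first by rewrite big_nil dvd1p.
case/andP => ir /IHr dr; rewrite big_cons Gauss_dvdp ?dvd //.
rewrite big_seq; apply: (big_ind (fun q => coprimep _ q)) => [|x y cx cy|j jr].
- exact: coprimep1.
- by rewrite coprimepMr cx cy.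
apply: coprimep_expl; apply: coprimep_expr; rewrite coprimep_XsubC root_XsubC.
by rewrite (inj_eq rho_inj); apply: contraNneq ir => <-.
Qed.

(** The forms orthogonal to all multiples of [P] are spanned by those that
    represent the Taylor coefficients of order less than [a i] at [rho i]:
    these conditions cut out the multiples of [P]. *)
Lemma apolar_span (d : nat) (rho : 'I_d -> L) (a : 'I_d -> nat) g :
  injective rho -> (\sum_i a i = n - d)%N -> (d <= n)%N ->
  (forall h : {poly L}, (size h <= d.+1)%N ->
    pairing (poly_rV (\prod_i ('X - (rho i)%:P) ^+ a i * h)) g = 0) ->
  exists h : 'I_d -> {poly L}, (forall i, (size (h i) <= a i)%N) /\
    g = poly_rV (\sum_i (1 + rho i *: 'X) ^+ (n - (a i).-1) * h i).
Proof.
move=> rho_inj sum_a dn g_orth; set P := \prod_i _ in g_orth.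
have a_le i : (a i <= n)%N.
  by rewrite (leq_trans _ (leq_subr d n)) // -sum_a (bigD1 i) //= leq_addr.
pose T : finType := ('I_d * 'I_n.+1)%type.
pose R (t : T) : 'rV[L]_n.+1 := if (t.2 < a t.1)%N then
  poly_rV ((1 + rho t.1 *: 'X) ^+ (n - t.2) * 'X^(t.2)) else 0.
pose M := \matrix_(r < #|T|) R (enum_val r).
have gM : (g <= M)%MS.
  rewrite submxE; apply/eqP/rowP => c; rewrite [RHS]mxE.
  (* Column [c] of the cokernel, as a form: it is orthogonal to all rows of
     [M], so it is a multiple of [P], and pairing with it is column [c]. *)
  pose w (j : 'I_n.+1) : L := (n`!)%:R^-1 * (j`! * (n - j)`!)%:R.
  have w0 j : w j != 0.
    by rewrite mulf_neq0 ?invr_eq0 // pchar0_natr_eq0 // -lt0n ?muln_gt0 ?fact_gt0.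
  pose f : 'rV[L]_n.+1 := \row_j (cokermx M j c / w j).
  have fE (y : 'rV[L]_n.+1) : pairing f y = (y *m cokermx M) 0 c.
    rewrite pairingE mxE; apply: eq_bigr => j _.
    by rewrite mxE -/(w j) mulrAC divfK // mulrC.
  have fR t : pairing f (R t) = 0.
    rewrite fE -[t]enum_rankK -(rowK (fun r => R (enum_val r))) -row_mul mulmx_coker.
    by rewrite !mxE.
  have dvdf : P %| rVpoly f.
    apply: dvdp_prod_exp_XsubC => // i; apply: dvdp_exp_XsubC => k ka.
    have kn : (k <= n)%N := leq_trans (ltnW ka) (a_le i).
    have := fR (i, Ordinal (kn : (k < n.+1)%N)); rewrite /R /= ka pairing_taylor // => /eqP.
    rewrite mulf_eq0 => /orP[|/eqP //].
    by rewrite (negbTE (w0 (Ordinal (kn : (k < n.+1)%N)))).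
  rewrite -fE; move: dvdf; rewrite dvdp_eq => /eqP ef.
  rewrite -(rVpolyK f) ef mulrC; apply: g_orth.
  set q := _ %/ _ in ef *; have [->|q0] := eqVneq q 0; first by rewrite size_poly0.
  have monP : P \is monic by apply: monic_prod => i _; apply/monic_exp/monicXsubC.
  have sizeP : size P = (n - d).+1.
    rewrite size_prod => [|i _]; last by rewrite expf_neq0 // polyXsubC_eq0.
    under eq_bigr do rewrite size_exp_XsubC -addn1.
    by rewrite big_split /= sum_a sum1_card card_ord -addSn addnK.
  have : (size (q * P)%R <= n.+1)%N by rewrite -ef; apply: size_poly.
  rewrite size_Mmonic // sizeP addnS /= => sz.
  by rewrite -(leq_add2r (n - d)) addSn subnKC.
have /submxP[u gu] := gM.
pose h i : {poly L} := \sum_(k < n.+1 | (k < a i)%N)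
  u 0 (enum_rank ((i, k) : T)) *: ((1 + rho i *: 'X) ^+ ((a i).-1 - k) * 'X^k).
exists h; split=> [i|].
  apply: leq_trans (size_sum _ _ _) _; apply/bigmax_leqP => k ka.
  apply: leq_trans (size_scale_leq _ _) _; apply: leq_trans (size_polyMleq _ _) _.
  rewrite size_polyXn addnS /=.
  have : (size ((1 + rho i *: 'X) ^+ ((a i).-1 - k))%R <= ((a i).-1 - k).+1)%N.
    apply/leq_sizeP => j; rewrite coef_exp_linear => jk.
    by rewrite bin_small ?mulr0n.
  rewrite -(leq_add2r k) => /leq_trans; apply.
  have ka' : (k <= (a i).-1)%N by rewrite -ltnS (ltn_predK ka).
  by rewrite addSn subnK // (ltn_predK ka).
rewrite gu mulmx_sum_row linear_sum /=.
rewrite (reindex (@enum_rank T)) /=; last by apply: onW_bij; exact: enum_rank_bij.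
under eq_bigr do rewrite rowK enum_rankK.
transitivity (\sum_(i < d) \sum_(k < n.+1) u 0 (enum_rank ((i, k) : T)) *: R (i, k)).
  by rewrite pair_bigA; apply: eq_bigr => -[].
apply: eq_bigr => i _; rewrite mulr_sumr linear_sum /= [RHS]big_mkcond /=.
apply: eq_bigr => k _; rewrite /R /=; case: ifP => [ka|_]; last by rewrite scaler0.
rewrite -scalerAr linearZ /= mulrA -exprD; congr (_ *: poly_rV (_ ^+ _ * _)).
rewrite addnBA; last by rewrite -ltnS (ltn_predK ka).
by rewrite subnK // (leq_trans (leq_pred _)).
Qed.

End Apolarity.

(** * The dual variety as a join of hook loci *)

Lemma projective_closure_sub (L : fieldType) (N : nat) (X Y : 'rV[L]_N -> Prop) a :
  (forall x, X x -> projective_closure Y x) ->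
  projective_closure X a -> projective_closure Y a.
Proof.
move=> XY [a0 Xa]; split=> // k F homF YF; apply: (Xa k F homF) => x /XY[_ Yx].
exact: Yx homF YF.
Qed.

(** Limits along polynomial families lie in the closure, since an equation of
    [X] pulls back to a polynomial function that vanishes where [W] does not. *)
Lemma projective_closure_density (L : fieldType) (N : nat) (V : lmodType L)
    (X : 'rV[L]_N -> Prop) (W : V -> L) (x : V -> 'rV[L]_N) (v : V) :
  [pchar L] =i pred0 -> polynomial_fun W -> (exists w, W w != 0) ->
  (forall i, polynomial_fun (fun w => x w 0 i)) ->
  (forall w, W w != 0 -> x w != 0 -> X (x w)) ->
  x v != 0 -> projective_closure X (x v).
Proof.
move=> charL pW exW px WX xv; split=> // k F homF XF.
have [i xi] : exists i, x v 0 i != 0.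
  apply/existsP; rewrite -negb_forall; apply: contra xv => /forallP x0.
  by apply/eqP/rowP => i; rewrite mxE; apply/eqP.
(* The coordinate discards the parameters at which the family passes through
   [0], where a constant equation need not vanish. *)
suff /eqP : F.@[x v 0] * x v 0 i = 0.
  by rewrite mulf_eq0 (negbTE xi) orbF => /eqP.
apply: (@polynomial_fun_density _ _ charL W (fun w => F.@[x w 0] * x w 0 i)) => // [|w Ww].
  by apply: polynomial_funM => //; apply: polynomial_fun_meval.
have [->|wi] := eqVneq (x w 0 i) 0; first by rewrite mulr0.
rewrite XF ?mul0r //; apply: WX => //; apply: contraNneq wi => ->.
by rewrite mxE.
Qed.

Lemma hook_exponent (n k : nat) : (2 <= k <= n)%N -> (n - k + 2 = n - k.-2)%N.
Proof.
case: k => [|[|k]] // kn; rewrite /= -[k.+2]addn2 subnDA subnK //.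
by rewrite leq_subRL ?addn2 // (leq_trans _ kn) // leqW.
Qed.

Section DualOfRootLocus.

Variables (L : closedFieldType) (n d : nat) (lam : d.-tuple nat).
Hypothesis charL : [pchar L] =i pred0.
Hypothesis sum_lam : sumn lam = n.
Hypothesis lam_gt0 : forall i, (0 < tnth lam i)%N.

Local Notation params := (L^o * 'M[L]_(d, 2))%type.
Local Notation index := {i : 'I_d | (2 <= tnth lam i)%N}.
Implicit Types (v w : params) (g : 'rV[L]_n.+1).

Definition orthogonal_to_reduced v g : Prop :=
  forall h : {poly L}, (size h <= d.+1)%N ->
    pairing (poly_rV (reduced_form lam v * h)) g = 0.

Lemma tnth_lam_le i : (tnth lam i <= n)%N.
Proof. by rewrite -(sum_tnth_lam sum_lam) (bigD1 i) //= leq_addr. Qed.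

Lemma size_hook_term (u : L * L) k (h : {poly L}) : (2 <= k <= n)%N ->
  (size h <= k - 1)%N -> (size (linear_poly u ^+ (n - k + 2) * h)%R <= n.+1)%N.
Proof.
case/andP=> k2 kn hk; apply: leq_trans (size_polyMleq _ _) _.
have := size_prod_linear_poly [:: tt] (fun=> u) (fun=> (n - k + 2)%N).
rewrite !big_seq1 => hu; have := leq_add hu hk.
have -> : ((n - k + 2).+1 + (k - 1) = n.+2)%N.
  rewrite addSn -addnA addnBA ?(ltnW k2) // [(2 + k)%N]addnC -addnBA //.
  by rewrite addnA subnK // addn1.
by case: (_ + _)%N.
Qed.

Lemma hook_locus_term (i : index) (u : L * L) (h : {poly L}) :
  u != 0 -> h != 0 -> (size h <= tnth lam (val i) - 1)%N ->
  @multiple_root_locus L n (hook n (tnth lam (val i)))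
    (poly_rV (linear_poly u ^+ (n - tnth lam (val i) + 2) * h)).
Proof.
move=> u0 h0 hs; have range_i : (2 <= tnth lam (val i) <= n)%N by rewrite (valP i) tnth_lam_le.
have eq_term := poly_rV_K (size_hook_term u range_i hs).
apply/hook_locusP => //; split; last by exists u, h.
apply: contraNneq h0 => e0; move: eq_term; rewrite e0 linear0 => /esym/eqP.
by rewrite mulf_eq0 expf_eq0 linear_poly_eq0 (negbTE u0) andbF.
Qed.

(** The form [p^(n - lam_i + 2) h], with [p] apolar to the [i]-th factor, represents
    a combination of Taylor coefficients of order at most [lam_i - 2] at the root
    of that factor, and these vanish on the multiples of the reduced form. *)
Lemma orthogonal_hook_term v (i : 'I_d) (h w : {poly L}) :
  (2 <= tnth lam i)%N -> v.2 i 1 != 0 ->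
  (size h <= tnth lam i - 1)%N -> (size w <= d.+1)%N ->
  pairing (poly_rV (reduced_form lam v * w) : 'rV_n.+1)
    (poly_rV (linear_poly (v.2 i 1, - v.2 i 0) ^+ (n - tnth lam i + 2) * h)) = 0.
Proof.
move=> i2 b0 hs ws; set rho := - (v.2 i 0 / v.2 i 1).
have -> : linear_poly (v.2 i 1, - v.2 i 0) = v.2 i 1 *: (1 + rho *: 'X).
  rewrite /linear_poly scalerDr alg_polyC scalerA /rho mulrN mulrCA divff // mulr1.
  by [].
have le := tnth_lam_le i.
have -> : (n - tnth lam i + 2 = n - (tnth lam i - 1).-1)%N.
  by rewrite hook_exponent ?i2 // subn1.
rewrite exprZn -scalerAl linearZ /= pairingZr orthogonal_taylor_span ?mulr0 //.
  exact: leq_trans (leq_subr _ _) (leqW le).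
move=> k ki; rewrite pairing_taylor //; last first.
  exact: leq_trans (ltnW ki) (leq_trans (leq_subr _ _) le).
rewrite poly_rV_K; last exact: size_reduced_formM.
rewrite /reduced_form (bigD1 i) //= -subn1.
have -> : param_linear v i = v.2 i 1 *: ('X - rho%:P).
  rewrite /param_linear /linear_poly /= /rho polyCN opprK scalerDr addrC; congr (_ + _).
  by rewrite -mul_polyC -polyCM mulrC divfK.
by rewrite exprZn -!scalerAl -[_ * _ * w]mulrA comp_polyZ coefZ coef_shift_exp_XsubC ?mulr0.
Qed.

(** Orthogonality to the multiples of the reduced form is a linear system with
    coefficients polynomial in [v], of full rank where the reduced form is not
    zero, so by Cramer's rule each solution there extends to a polynomial family
    of solutions. *)
Lemma orthogonal_to_reduced_deformation v g :
  reduced_form lam v != 0 -> orthogonal_to_reduced v g ->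
  exists x : params -> 'rV[L]_n.+1,
    [/\ forall i, polynomial_fun (fun w => x w 0 i), x v = g &
        forall w, orthogonal_to_reduced w (x w)].
Proof.
move=> r0 vg.
pose c (j : 'I_n.+1) : L := (n`!)%:R^-1 * (j`! * (n - j)`!)%:R.
have c0 j : c j != 0.
  by rewrite mulf_neq0 ?invr_eq0 // pchar0_natr_eq0 // -lt0n ?muln_gt0 ?fact_gt0.
pose M w : 'M[L]_(d.+1, n.+1) := \matrix_(k, j) ((reduced_form lam w * 'X^k)`_j * c j).
have pM i j : polynomial_fun (fun w => M w i j).
  apply: (@eq_polynomial_fun _ _ (fun w => (reduced_form lam w * 'X^i)`_j * c j)).
    by move=> w; rewrite mxE.
  apply: polynomial_funM; last exact: polynomial_fun_const.
  by apply: poly_familyM; [apply: poly_family_reduced_form | apply: poly_family_const].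
have ME w (y : 'rV[L]_n.+1) k :
    (M w *m y^T) k 0 = pairing (poly_rV (reduced_form lam w * 'X^k)) y.
  rewrite pairingE mxE; apply: eq_bigr => j _.
  by rewrite !mxE mulrAC.
have Mg : M v *m g^T = 0.
  apply/colP => k; rewrite ME vg ?mxE // size_polyXn.
  exact: ltn_ord.
have /row_freeP[B MB] : row_free (M v).
  rewrite -kermx_eq0; apply/eqP/row_matrixP => r; rewrite row0.
  set u := row r _; have uM : u *m M v = 0.
    by rewrite /u -row_mul mulmx_ker row0.
  have : reduced_form lam v * rVpoly u = 0.
    apply/polyP => j; rewrite coef0; have [jn|jn] := ltnP j n.+1; last first.
      apply: nth_default; apply: leq_trans jn.
      by apply: size_reduced_formM => //; apply: size_rVpoly.
    have /rowP/(_ (Ordinal jn)) := uM; rewrite !mxE => e.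
    apply: (mulIf (c0 (Ordinal jn))); rewrite mul0r -[RHS]e rVpolyE mulr_sumr coef_sum mulr_suml.
    by apply: eq_bigr => k _; rewrite [M v k _]mxE -scalerAr coefZ -!mulrA.
  by move/eqP; rewrite mulf_eq0 (negbTE r0) /= => /eqP e; rewrite -[u]rVpolyK e linear0.
pose N w := M w *m B.
have pN i j : polynomial_fun (fun w => N w i j).
  by apply: polynomial_fun_mulmx => // i' j'; apply: polynomial_fun_const.
(* The correction of [det (N w) g] is the solution by Cramer's rule, in the
   column space of [B], of the system that makes [y w] orthogonal. *)
pose y w : 'cV[L]_n.+1 := \det (N w) *: g^T - B *m (\adj (N w) *m (M w *m g^T)).
exists (fun w => (y w)^T); split.
- move=> i; apply: (@eq_polynomial_fun _ _ (fun w => \det (N w) * g 0 i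
      - (B *m (\adj (N w) *m (M w *m g^T))) i 0)).
    by move=> w; rewrite !mxE.
  apply: polynomial_funD.
    by apply: polynomial_funM; [apply: polynomial_fun_det | apply: polynomial_fun_const].
  apply: polynomial_funN; apply: polynomial_fun_mulmx => *; first exact: polynomial_fun_const.
  apply: polynomial_fun_mulmx => *; first exact: polynomial_fun_adj.
  by apply: polynomial_fun_mulmx => // *; apply: polynomial_fun_const.
- by rewrite /y /N MB det1 scale1r Mg !mulmx0 subr0 trmxK.
move=> w h hd.
have Mw : M w *m ((y w)^T)^T = 0.
  rewrite trmxK /y mulmxBr -scalemxAr mulmxA -/(N w) mulmxA mul_mx_adj mul_scalar_mx.
  by rewrite subrr.
rewrite (_ : h = \sum_(k < d.+1) h`_k *: 'X^k); last first.
  rewrite -poly_def; apply/polyP => k; rewrite coef_poly; case: ltnP => // dk.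
  by rewrite nth_default // (leq_trans hd).
rewrite mulr_sumr linear_sum /=.
have pairing_suml (I : Type) (r : seq I) (f : I -> 'rV[L]_n.+1) (z : 'rV[L]_n.+1) :
    (forall i, pairing (f i) z = 0) -> pairing (\sum_(i <- r) f i) z = 0.
  move=> f0; rewrite pairingE; under eq_bigr do rewrite summxE !mulr_suml.
  by rewrite exchange_big big1 //= => i _; rewrite -[RHS](f0 i) pairingE.
apply: pairing_suml => k.
by rewrite -scalerAr linearZ /= pairingZl -ME Mw mxE mulr0.
Qed.

(** This is [apolar_span] at the roots of the linear factors; the parts equal to
    [1] contribute nothing. *)
Lemma orthogonal_to_reduced_sum v g : distinct_roots_fun v != 0 -> g != 0 ->
  orthogonal_to_reduced v g ->
  exists q : index -> 'rV[L]_n.+1,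
    (forall i, @multiple_root_locus L n (hook n (tnth lam (val i))) (q i)) /\
    g \in (\sum_(i : index) <[q i]>)%VS.
Proof.
move=> /distinct_rootsP[b0 rho_inj lE] g0 vg; set rho := (fun i => - _) in rho_inj lE.
have [|h [hs ->]] := @apolar_span L n charL d rho (fun i => (tnth lam i).-1) g
    rho_inj (sum_pred_tnth_lam sum_lam lam_gt0) (le_size_lam sum_lam lam_gt0).
  move=> h hd; have bP : \prod_i v.2 i 1 ^+ (tnth lam i).-1 != 0.
    by apply/prodf_neq0 => i _; rewrite expf_neq0.
  have rE : reduced_form lam v =
      (\prod_i v.2 i 1 ^+ (tnth lam i).-1) *: \prod_i ('X - (rho i)%:P) ^+ (tnth lam i).-1.
    rewrite /reduced_form -scaler_prod; apply: eq_bigr => i _.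
    by rewrite lE exprZn.
  by apply: (mulfI bP); rewrite mulr0 -pairingZl -linearZ /= scalerAl -rE; apply: vg.
have pos i : (2 <= tnth lam i)%N -> (n - (tnth lam i).-2 = n - tnth lam i + 2)%N.
  by move=> i2; rewrite hook_exponent ?i2 ?tnth_lam_le.
(* Where the summand is zero, any point of the hook locus will do. *)
pose e (i : index) : {poly L} := if h (val i) == 0 then 1 else h (val i).
pose q (i : index) : 'rV[L]_n.+1 :=
  poly_rV (linear_poly (1, rho (val i)) ^+ (n - tnth lam (val i) + 2) * e i).
exists q; split=> [i|].
  apply: hook_locus_term; first by rewrite xpair_eqE oner_eq0.
    by rewrite /e; case: ifP => [_|/negbT //]; rewrite oner_eq0.
  rewrite /e subn1; case: eqP => // _; rewrite size_poly1.
  by rewrite -ltnS (ltn_predK (valP i)) (valP i).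
rewrite linear_sum; apply: memv_suml => i _ /=.
have [i2|i1] := leqP 2 (tnth lam i); last first.
  have -> : h i = 0.
    apply/eqP; rewrite -size_poly_leq0 (leq_trans (hs i)) //.
    by case: (tnth lam i) i1 => [|[]].
  by rewrite mulr0 linear0 mem0v.
pose j : index := exist _ i i2.
apply: (subvP (sumv_sup j (erefl true) (subvv _))).
have [hi0|hi0] := eqVneq (h i) 0; first by rewrite hi0 mulr0 linear0 mem0v.
by rewrite pos // /q /e /= (negbTE hi0) memv_line.
Qed.

(** The tangent space at a smooth point contains all multiples of the reduced
    form; an orthogonal form deforms to distinct roots, where it is a sum of
    points of the hook loci. *)
Lemma dual_root_locus_sub_join g :
  dual_variety (@multiple_root_locus L n lam) g ->
  join (fun i : index => @multiple_root_locus L n (hook n (tnth lam (val i)))) g.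
Proof.
apply: projective_closure_sub => {}g [g0 [f [[/(multiple_root_locus_cone_point sum_lam lam_gt0)]]]].
move=> [f0 [v ef]] _ Tg.
have Fv : param_form lam v != 0.
  by apply: contraNneq f0 => F0; rewrite ef /cone_point F0 linear0.
have v1 : v.1 != 0 by apply: contraNneq Fv => v1; rewrite /param_form v1 scale0r.
have r0 : reduced_form lam v != 0.
  apply/prodf_neq0 => i _; apply: expf_neq0; apply: contraNneq Fv => li0.
  by rewrite /param_form (bigD1 i) //= li0 expr0n eqn0Ngt lam_gt0 mul0r scaler0.
have vg : orthogonal_to_reduced v g.
  move=> h hd; apply: (mulfI v1); rewrite mulr0 -pairingZl -linearZ /=; apply: Tg.
  by rewrite ef; apply/(tangent_spaceP charL sum_lam lam_gt0); apply: cone_tangent_reduced_multiple.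
have [x [px xv xw]] := orthogonal_to_reduced_deformation r0 vg.
rewrite -xv; apply: (projective_closure_density charL (@polynomial_fun_distinct_roots L d)) => //.
- exact: exists_distinct_roots.
- by move=> w dw xw0; split=> //; apply: orthogonal_to_reduced_sum (xw w).
by rewrite xv.
Qed.

(** Each hook term determines the linear factor apolar to its linear form;
    factors for parts equal to [1] are free.  Moving all these factors to general
    position moves the sum to a form orthogonal to the tangent space at a smooth
    point. *)
Lemma join_sub_dual_root_locus g :
  join (fun i : index => @multiple_root_locus L n (hook n (tnth lam (val i)))) g ->
  dual_variety (@multiple_root_locus L n lam) g.
Proof.
apply: projective_closure_sub => {}g [g0 [q [hq /memv_sumP[r rq gr]]]].
have hq' (i : index) : exists z : L * L * {poly L}, (size z.2 <= tnth lam (val i) - 1)%N /\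
    r i = poly_rV (linear_poly z.1 ^+ (n - tnth lam (val i) + 2) * z.2).
  have [|_ [u [h [hs eh]]]] := (hook_locusP (q i) (k := tnth lam (val i)) _).1 (hq i).
    by rewrite (valP i) tnth_lam_le.
  have /vlineP[c ->] := rq i isT.
  exists (u, c *: h); split; first exact: leq_trans (size_scale_leq _ _) _.
  by rewrite -scalerAr linearZ /= -eh rVpolyK.
have [z hz] := fin_all_exists hq'.
have [W [pW exW hW]] := generic_smooth_point charL sum_lam lam_gt0.
pose x v : 'rV[L]_n.+1 := \sum_(i : index)
  poly_rV (linear_poly (v.2 (val i) 1, - v.2 (val i) 0) ^+ (n - tnth lam (val i) + 2) * (z i).2).
pose v : params := (1, \matrix_(i, j) if insub i is Some k then
  (if j == 0 then - (z k).1.2 else (z k).1.1) else 0).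
have xv : x v = g.
  rewrite gr; apply: eq_bigr => i _; have [_ ->] := hz i.
  by rewrite !mxE valK /= opprK -surjective_pairing.
rewrite -xv; apply: (projective_closure_density (W := fun v => W v * \prod_i v.2 i 1)) => //.
- apply: polynomial_funM => //; apply: polynomial_fun_prod => i.
  exact: polynomial_fun_entry.
- apply: polynomial_fun_common_nonzero => //.
    by apply: polynomial_fun_prod => i; apply: polynomial_fun_entry.
  exists (0, const_mx 1); apply/prodf_neq0 => i _.
  by rewrite mxE oner_eq0.
- move=> j; pose P v := \sum_(i : index)
    linear_poly (v.2 (val i) 1, - v.2 (val i) 0) ^+ (n - tnth lam (val i) + 2) * (z i).2.
  apply: (@eq_polynomial_fun _ _ (fun v => (P v)`_j)).
    by move=> w; rewrite /x -linear_sum mxE.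
  move: (j : nat); apply: poly_family_sum => i; apply: poly_familyM; last exact: poly_family_const.
  apply: poly_familyX; apply: poly_familyD => k.
    apply: (@eq_polynomial_fun _ _ (fun v => if k == 0%N then v.2 (val i) 1 else 0)).
      by move=> w; rewrite coefC.
    by case: (k == 0%N); [apply: polynomial_fun_entry | apply: polynomial_fun_const].
  apply: poly_familyZ; last exact: poly_family_const.
  by apply: polynomial_funN; apply: polynomial_fun_entry.
- move=> w; rewrite mulf_eq0 negb_or => /andP[/hW[smooth tangent] /prodf_neq0 b0] xw0.
  split=> //; exists (cone_point n lam w); split=> // y /tangent[h hd ->].
  rewrite linearZ /= pairingZl /x pairing_sumr big1 ?mulr0 // => i _.
  by apply: orthogonal_hook_term => //; [exact: (valP i) | exact: b0 | case: (hz i)].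
by rewrite xv.
Qed.

End DualOfRootLocus.

Lemma card_parts_ge2 (d : nat) (lam : d.-tuple nat) : all (fun k => (0 < k)%N) lam ->
  #|{: {i : 'I_d | (2 <= tnth lam i)%N}}| = (d - count_mem 1%N lam)%N.
Proof.
move=> /all_tnthP lam_gt0; rewrite card_sig.
have -> : count_mem 1%N lam = #|[pred i | tnth lam i == 1%N]|.
  by rewrite -sum1_count big_tuple sum1_card.
rewrite -[d in (d - _)%N]card_ord -(cardC [pred i | tnth lam i == 1%N]) addKn.
apply: eq_card => i; rewrite !inE.
by case: (tnth lam i) (lam_gt0 i) => [|[|]].
Qed.

Theorem corollary2p6 (K : fieldType) (charK : [pchar K] =i pred0)
    (L : closedFieldType) (iota : {rmorphism K -> L})
    (algL : forall z : L, algebraicOver iota z)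
    (n d m1 : nat) (lam : d.-tuple nat)
    (lam_partition : is_partition n lam)
    (lam_m1 : count_mem 1%N lam = m1) :
  #|{: {i : 'I_d | (2 <= tnth lam i)%N}}| = (d - m1)%N /\
  (forall g : 'rV[L]_n.+1,
     dual_variety (@multiple_root_locus L n lam) g <->
     join (fun i : {i : 'I_d | (2 <= tnth lam i)%N} =>
             @multiple_root_locus L n (hook n (tnth lam (val i)))) g).
Proof.
have [_ lam_pos /eqP sum_lam] := and3P lam_partition.
have charL : [pchar L] =i pred0 by move=> p; rewrite (fmorph_pchar iota).
have lam_gt0 i : (0 < tnth lam i)%N by exact: (elimT all_tnthP lam_pos i).
split; first by rewrite card_parts_ge2 ?lam_m1.
move=> g; split.
  exact: dual_root_locus_sub_join.
exact: join_sub_dual_root_locus.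
Qed.
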